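(* There exists a quantum oracle $A$ such that $\mathsf{QSZK}_{\mathsf{HV}}^A \not\subseteq \mathsf{QCMA}^A$.
   Context: A quantum oracle is a collection $A=\{A_n\}_{n\ge1}$ of quantum operations (superoperators, which one may think of as unitaries on larger spaces), $A_n$ acting on a number of qubits polynomial in $n$; an algorithm with access to $A$ may apply any $A_n$ as a black box at unit cost per call. $\mathsf{QCMA}^A$: languages $L$ for which there is a polynomial-time quantum verifier $V$ with access to $A$ such that if $x\in L$ there is a classical polynomial-length string $w$ with $\Pr[V^A(x,w)\text{ accepts}]\ge 2/3$, and if $x\notin L$ then for all such $w$, $\Pr[V^A(x,w)\text{ accepts}]\le 1/3$. $\mathsf{QSZK}_{\mathsf{HV}}^A$ (honest-verifier quantum statistical zero knowledge relative to $A$): languages $L$ such that (1) there is a quantum interactive proof system for $L$ in which the polynomial-time quantum verifier has access to $A$ and exchanges quantum messages with an unbounded prover: for $x\in L$ some prover makes the verifier accept with probability at least $a$, and for $x\notin L$ every prover makes the verifier accept with probability at most $b$, where $a>b$ with at least an inverse polynomial gap; and (2) if $x\in L$, the state of the (honest) verifier in this proof system after the sending of each message can be approximated, within negligible trace distance, by a quantum state that can be prepared in polynomial time with access to $A$. *)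

(* Defs.v *)
From HB Require Import structures.
From mathcomp Require Import all_boot all_order all_algebra.
From mathcomp Require Import boolp classical_sets reals.
From mathcomp Require Import complex.

Set Implicit Arguments.
Unset Strict Implicit.
Unset Printing Implicit Defensive.

Import Order.TTheory GRing.Theory Num.Theory.
Local Open Scope ring_scope.
Local Open Scope sesquilinear_scope.

(** Deterministic Turing machines with [tm_tapes.+1] two-way infinite tapes over
    the alphabet {blank, 0, 1}, where [None] is the blank.  The first tape holds
    the input and the last one the output. *)

Inductive move := MoveLeft | Stay | MoveRight.

Record turing_machine := TuringMachine {
  tm_tapes : nat;
  tm_state : finType;
  tm_start : tm_state;
  tm_halt : pred tm_state;
  tm_delta : tm_state -> {ffun 'I_tm_tapes.+1 -> option bool} ->
             tm_state * ('I_tm_tapes.+1 -> option bool * move)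
}.

Definition tape := int -> option bool.

Definition tape_of (s : seq bool) : tape :=
  fun z => if z is Posz i then onth s i else None.

Record tm_config (M : turing_machine) := TMConfig {
  cfg_state : tm_state M;
  cfg_head : 'I_(tm_tapes M).+1 -> int;
  cfg_tape : 'I_(tm_tapes M).+1 -> tape
}.

Definition tm_init (M : turing_machine) (s : seq bool) : tm_config M :=
  TMConfig (tm_start M) (fun=> 0)
    (fun i => if i == ord0 then tape_of s else fun=> None).

Definition move_head (z : int) (d : move) : int :=
  match d with MoveLeft => z - 1 | Stay => z | MoveRight => z + 1 end.

Definition tm_step (M : turing_machine) (c : tm_config M) : tm_config M :=
  if tm_halt (cfg_state c) then c else
  let d := tm_delta (cfg_state c) [ffun i => cfg_tape c i (cfg_head c i)] in
  TMConfig d.1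
    (fun i => move_head (cfg_head c i) (d.2 i).2)
    (fun i z => if z == cfg_head c i then (d.2 i).1 else cfg_tape c i z).

(** The output is read on the cells 0, 1, 2, ... of the last tape, wherever its
    head stands; these cells must hold the output followed by blanks only. *)
Definition tm_outputs (M : turing_machine) (s : seq bool) (t : nat)
    (out : seq bool) : Prop :=
  let c := iter t (@tm_step M) (tm_init M s) in
  tm_halt (cfg_state c) /\ forall i : nat, cfg_tape c ord_max i%:Z = onth out i.

Definition polytime (S T : Type) (eS : S -> seq bool) (eT : T -> seq bool)
    (f : S -> T) : Prop :=
  exists (M : turing_machine) (p : {poly nat}),
    forall s, tm_outputs M (eS s) p.[size (eS s)] (eT (f s)).

(** [enc_nat], [enc_seq] and the encodings built from them below are prefix-free;
    naturals are written in unary, their values being polynomially bounded. *)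

Definition enc_nat (n : nat) : seq bool := nseq n true ++ [:: false].

Definition enc_seq (T : Type) (e : T -> seq bool) (s : seq T) : seq bool :=
  flatten [seq true :: e x | x <- s] ++ [:: false].

Definition enc_pair (u : seq bool * seq bool) : seq bool :=
  enc_seq (fun b => [:: b]) u.1 ++ u.2.

Section Operators.
Variable R : realType.

(** Operators on [k] qubits.  The rows and columns are indexed by the
    computational basis [k.-tuple bool] through its enumeration. *)
Definition qop (k : nat) := 'M[R[i]]_#|{: k.-tuple bool}|.

Definition mkop (k : nat) (f : k.-tuple bool -> k.-tuple bool -> R[i]) : qop k :=
  \matrix_(i, j) f (enum_val i) (enum_val j).

(** [entry K x y] is <x|K|y>. *)
Definition entry (k : nat) (K : qop k) (x y : k.-tuple bool) : R[i] :=
  K (enum_rank x) (enum_rank y).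

Definition read_wires (N k : nat) (ws : seq nat) (x : N.-tuple bool) :
    k.-tuple bool :=
  [tuple nth false x (nth 0%N ws i) | i < k].

(** [K] applied to the wires [ws] of an [N]-qubit register, tensored with the
    identity on the other wires. *)
Definition lift_op (N k : nat) (ws : seq nat) (K : qop k) : qop N :=
  mkop (fun x y =>
    if [forall i : 'I_N, (val i \notin ws) ==> (tnth x i == tnth y i)]
    then entry K (read_wires k ws x) (read_wires k ws y) else 0).

(** Quantum operations in operator-sum form. *)
Record qoperation (k : nat) := QOperation {
  kraus : seq (qop k);
  kraus_complete : \sum_(K <- kraus) (K^t* *m K) = 1%:M
}.

Definition apply_qoperation (N k : nat) (ws : seq nat) (E : qoperation k)
    (rho : qop N) : qop N :=
  \sum_(K <- kraus E) (lift_op N ws K *m rho *m (lift_op N ws K)^t*).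

Definition apply_unitary (N k : nat) (ws : seq nat) (U : qop k)
    (rho : qop N) : qop N :=
  lift_op N ws U *m rho *m (lift_op N ws U)^t*.

Definition zero_state (N : nat) : qop N :=
  mkop (fun x y =>
    ((x == nseq N false :> seq bool) && (y == nseq N false :> seq bool))%:R).

(** Partial trace over the last [p] qubits. *)
Definition ptrace (n p : nat) (rho : qop (n + p)) : qop n :=
  mkop (fun x y =>
    \sum_(z : p.-tuple bool) entry rho (cat_tuple x z) (cat_tuple y z)).

(** Probability of observing 1 when measuring qubit 0. *)
Definition prob_one (N : nat) (rho : qop N) : R :=
  complex.Re (\sum_(x : N.-tuple bool | nth false x 0) entry rho x x).

(** The trace norm is tr sqrt(X^* X). *)
Definition trace_norm (k : nat) (X : qop k) : R :=
  complex.Re (\sum_i sqrtC (spectral_diag (X^t* *m X) 0 i)).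

Definition trace_distance (k : nat) (rho sigma : qop k) : R :=
  trace_norm (rho - sigma) / 2%:R.

Definition hadamard : qop 1 :=
  mkop (fun x y => (sqrtC 2%:R)^-1 * (-1) ^+ (thead x && thead y)).

Definition phase : qop 1 :=
  mkop (fun x y => (x == y)%:R * 'i ^+ thead x).

Definition cnot : qop 2 :=
  mkop (fun x y => let b := nth false y in
    (x == [:: b 0%N; b 1%N (+) b 0%N] :> seq bool)%:R).

Definition toffoli : qop 3 :=
  mkop (fun x y => let b := nth false y in
    (x == [:: b 0%N; b 1%N; b 2%N (+) (b 0%N && b 1%N)] :> seq bool)%:R).

End Operators.

Record quantum_oracle (R : realType) := QuantumOracle {
  oracle_qubits : nat -> nat;
  oracle_qubits_poly :
    exists p : {poly nat}, forall n, (oracle_qubits n <= p.[n])%N;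
  oracle_op : forall n, qoperation R (oracle_qubits n)
}.

(** [Call n ws] applies the [n]-th oracle operation to the wires [ws].  There are
    no measurement or discarding gates, so that a party running a circuit keeps
    all of its qubits. *)
Inductive gate :=
  | Had of nat
  | Phase of nat
  | CNot of nat & nat
  | Toffoli of nat & nat & nat
  | Call of nat & seq nat.

Definition circuit := seq gate.

Definition enc_gate (g : gate) : seq bool :=
  match g with
  | Had i => enc_nat 0 ++ enc_nat i
  | Phase i => enc_nat 1 ++ enc_nat i
  | CNot i j => enc_nat 2 ++ enc_nat i ++ enc_nat j
  | Toffoli i j k => enc_nat 3 ++ enc_nat i ++ enc_nat j ++ enc_nat k
  | Call n ws => enc_nat 4 ++ enc_nat n ++ enc_seq enc_nat ws
  end.

Definition enc_circuit : circuit -> seq bool := enc_seq enc_gate.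

Section Classes.
Variables (R : realType) (A : quantum_oracle R).

Definition gate_wires (g : gate) : seq nat :=
  match g with
  | Had i | Phase i => [:: i]
  | CNot i j => [:: i; j]
  | Toffoli i j k => [:: i; j; k]
  | Call _ ws => ws
  end.

Definition gate_wf (N : nat) (g : gate) : bool :=
  [&& uniq (gate_wires g), all (fun w => w < N)%N (gate_wires g) &
      if g is Call n ws then (0 < n)%N && (size ws == oracle_qubits A n)
      else true].

Definition circuit_wf (N : nat) (c : circuit) : bool := all (gate_wf N) c.

Definition run_gate (N : nat) (rho : qop R N) (g : gate) : qop R N :=
  match g with
  | Had _ => apply_unitary (gate_wires g) (hadamard R) rho
  | Phase _ => apply_unitary (gate_wires g) (phase R) rho
  | CNot _ _ => apply_unitary (gate_wires g) (cnot R) rho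
  | Toffoli _ _ _ => apply_unitary (gate_wires g) (toffoli R) rho
  | Call n ws => apply_qoperation ws (oracle_op A n) rho
  end.

Definition run (N : nat) (c : circuit) (rho : qop R N) : qop R N :=
  foldl (@run_gate N) rho c.

(** A width and a circuit, run on the all-zero state. *)
Definition algorithm := (nat * circuit)%type.

Definition enc_algorithm (q : algorithm) : seq bool :=
  enc_nat q.1 ++ enc_circuit q.2.

Definition accept_prob (q : algorithm) : R :=
  prob_one (run q.2 (zero_state R q.1)).

Definition QCMA : set (set (seq bool)) :=
  [set L | exists (V : seq bool * seq bool -> algorithm) (p : {poly nat}),
    [/\ polytime enc_pair enc_algorithm V,
        forall u, circuit_wf (V u).1 (V u).2,
        forall x, L x -> exists w : seq bool,
          (size w <= p.[size x])%N /\ 2%:R / 3%:R <= accept_prob (V (x, w)) &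
        forall x, ~ L x -> forall w : seq bool,
          (size w <= p.[size x])%N -> accept_prob (V (x, w)) <= 1 / 3%:R]].

(** The verifier on a fixed input, with [vpriv] private qubits (the first ones)
    and [vmsg] message qubits.  It runs the successive circuits of [vrounds],
    each followed by a message to the prover and a reply, and finally [vfinal].
    A protocol where the prover speaks first has an empty first circuit. *)
Record verifier := Verifier {
  vpriv : nat;
  vmsg : nat;
  vrounds : seq circuit;
  vfinal : circuit
}.

Definition enc_verifier (v : verifier) : seq bool :=
  enc_nat (vpriv v) ++ enc_nat (vmsg v) ++
  enc_seq enc_circuit (vrounds v) ++ enc_circuit (vfinal v).

Definition verifier_wf (v : verifier) : bool :=
  all (circuit_wf (vpriv v + vmsg v)) (rcons (vrounds v) (vfinal v)).

(** A prover with [prover_priv] private qubits; its [i]-th operation acts on the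
    message qubits followed by its private qubits. *)
Record prover (m : nat) := Prover {
  prover_priv : nat;
  prover_op : nat -> qoperation R (m + prover_priv)
}.

Section Interaction.
Variables (v : verifier) (P : prover (vmsg v)).

Let N := (vpriv v + vmsg v + prover_priv P)%N.

(** Global state after [i] full rounds; the circuits of the verifier only address
    the wires below [vpriv v + vmsg v]. *)
Fixpoint round_state (i : nat) : qop R N :=
  if i is i'.+1 then
    apply_qoperation (iota (vpriv v) (vmsg v + prover_priv P)) (prover_op P i')
      (run (nth [::] (vrounds v) i') (round_state i'))
  else zero_state R N.

(** Global state after [j] messages; odd messages come from the verifier. *)
Definition message_state (j : nat) : qop R N :=
  if odd j then run (nth [::] (vrounds v) j./2) (round_state j./2)
  else round_state j./2.

Definition verifier_view (j : nat) : qop R (vpriv v + vmsg v) :=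
  ptrace (message_state j).

Definition interaction_accept_prob : R :=
  prob_one (ptrace (run (vfinal v) (round_state (size (vrounds v))))
            : qop R (vpriv v + vmsg v)).

End Interaction.

(** [(anc, c)] prepares a state of [n] qubits by running [c] on [n + anc] qubits
    and tracing out the last [anc] ones. *)
Definition preparation := (nat * circuit)%type.

Definition prepared_state (n : nat) (s : preparation) : qop R n :=
  @ptrace R n s.1 (run s.2 (zero_state R (n + s.1))).

Definition binary_value (s : seq bool) : nat :=
  foldr (fun (b : bool) n => b + n.*2)%N 0%N s.

(** [n |-> a n] is a rational number with numerator and denominator computed in
    time polynomial in [n].  Without such a requirement, the thresholds [a] and
    [b] of a proof system would act as an arbitrary advice on the input length. *)
Definition polytime_threshold (a : nat -> R) : Prop :=
  exists f : nat -> seq bool * seq bool,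
    polytime (fun n => nseq n true) enc_pair f /\
    forall n, a n = (binary_value (f n).1)%:R / (binary_value (f n).2)%:R.

Definition inverse_poly_gap (a b : nat -> R) : Prop :=
  exists p : {poly nat}, forall n,
    (0 < p.[n])%N /\ (p.[n]%:R)^-1 <= a n - b n.

Definition negligible (eps : nat -> R) : Prop :=
  forall p : {poly nat}, exists n0 : nat, forall n, (n0 <= n)%N ->
    `|eps n| * p.[n]%:R <= 1.

(** The list [S x] has one preparation for each message. *)
Definition QSZK_HV : set (set (seq bool)) :=
  [set L | exists (V : seq bool -> verifier) (a b : nat -> R)
                  (S : seq bool -> seq preparation) (eps : nat -> R),
    [/\ polytime id enc_verifier V /\ (forall x, verifier_wf (V x)),
        [/\ polytime_threshold a, polytime_threshold b & inverse_poly_gap a b],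
        polytime id (enc_seq enc_algorithm) S /\ negligible eps,
        forall x, L x -> exists P : prover (vmsg (V x)),
          a (size x) <= interaction_accept_prob P /\
          size (S x) = (size (vrounds (V x))).*2 /\
          forall j, (j < size (S x))%N ->
            let n := (vpriv (V x) + vmsg (V x))%N in
            let s := nth (0%N, [::]) (S x) j in
            circuit_wf (n + s.1) s.2 /\
            trace_distance (prepared_state n s) (verifier_view P j.+1)
              <= eps (size x) &
        forall x, ~ L x -> forall P : prover (vmsg (V x)),
          interaction_accept_prob P <= b (size x)]].

End Classes.

(* Main.v *)
(** The [j]-th oracle operation resets its qubits to a fresh sample [(c, ~~ c, 0, y)]
    with [y] a uniform string of [j - 3] bits, where [c] is either the value [f y] of
    a hidden function or an independent uniform bit; the language asks which.

    Proof system: the verifier draws a sample, keeps [(c, ~~ c)], sends [y] and asks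
    for [~~ c].  With a hidden function the prover answers perfectly, and the reply
    can be simulated by copying the bit [~~ c] that the verifier holds.  Without one,
    flipping the first two qubits is a symmetry of the state which exchanges success
    and failure, so that every prover succeeds with probability 1/2.

    Classical witnesses: replacing the calls one by one, the two kinds of oracles are
    told apart on a given witness only if [f] correlates with one of the functions
    obtained by fixing the samples of the previous calls.  These functions do not
    depend on [f] and there are at most exponentially many of them, over all witnesses,
    whereas [y] takes 2^n values.  A discrepancy argument provides [f] correlated with
    none.  The theorem follows by diagonalization against the countably many
    polynomial-time verifiers. *)
Require Import Defs.
From mathcomp Require Import all_boot all_order all_algebra.
From mathcomp Require Import boolp classical_sets reals complex.
From mathcomp Require Import zify ring lra.

Set Implicit Arguments.
Unset Strict Implicit.
Unset Printing Implicit Defensive.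

Import Order.TTheory GRing.Theory Num.Theory.

(** * Polynomial-time transducers *)

(** A call overwrites its qubits, so the state after it is an average over samples of states in
    which the sample is a fixed string. The branch of a given sample is the same whether or not a
    function is hidden; this is why the functions to be avoided can be listed before [f] is chosen.
    With [T] gates and witnesses of length [P], their number has a logarithm [L] of order
    [P + (n + 2) * T], and suitable signs on [2 ^ n] points have with each of them a correlation of
    relative size of order [sqrt (L / 2 ^ n)]. Only an inverse polynomial is required, about [1 / T]
    per call, so it suffices that [2 ^ n] exceed a polynomial.

    The signs are chosen one by one, by conditional expectations on a product that takes the place
    of an exponential moment.

    Polynomial time refers to actual Turing machines. The verifier and the simulator depend only on
    the input length, and their encodings consist of constants, numbers [n + k] in unary and the
    wires [n + 2, ..., 0]; the commands below produce just these. *)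

Inductive command := Emit of bool | Load | Inc | Flush | Tri.

(** A block of [k] marks is the list separator [true] followed by [k - 1] in unary: up to the final
    [false], this is the encoding of the list of wires [k - 1, ..., 0]. *)
Fixpoint triangle (k : nat) : seq bool :=
  if k is k'.+1 then nseq k true ++ false :: triangle k' else [::].

(* A register machine with a counter [k] and an output string; [n] is the input
   length. *)
Definition exec_command (n : nat) (c : command) (r : nat * seq bool) :=
  match c with
  | Emit b => (r.1, rcons r.2 b)
  | Load => ((r.1 + n)%N, r.2)
  | Inc => (r.1.+1, r.2)
  | Flush => (0%N, r.2 ++ nseq r.1 true)
  | Tri => (0%N, r.2 ++ triangle r.1)
  end.

Definition exec (n : nat) (p : seq command) (r : nat * seq bool) :=
  foldl (fun r c => exec_command n c r) r p.

(** Exact step counts. In [Tri], a row of length [l] takes [2 * l + 3] steps, and one more erases a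
    mark or leaves the command; the quadratic is the sum of [2 * l + 4] over [l <= k]. *)
Definition command_cost (n : nat) (c : command) (k : nat) : nat :=
  match c with
  | Emit _ | Inc => 1
  | Load => n.+1 + n.+1
  | Flush => k.+2
  | Tri => (k * (k + 5) + 4)%N
  end.

Fixpoint exec_cost (n : nat) (p : seq command) (r : nat * seq bool) : nat :=
  if p is c :: p' then
    (command_cost n c r.1 + exec_cost n p' (exec_command n c r))%N
  else 0%N.

Lemma rcons_nseq (T : Type) (x : T) (n : nat) : rcons (nseq n x) x = nseq n.+1 x.
Proof. by elim: n => //= n ->. Qed.

Section ScriptMachine.
Variable p : seq command.

Definition script_state : finType := ('I_(size p).+1 * 'I_4)%type.

Definition action :=
  (script_state * move * option (option bool) * move * option bool)%type.

(* Tape 0 is the input, tape 1 holds the counter in unary, tape 2 is the output.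
   Between commands the input head is at 0 and the counter head just after the
   last mark. *)
Definition script_action (q : script_state) (b0 b1 : bool) : action :=
  let stay i : script_state := (q.1, inord i) in
  let next : script_state := (inord q.1.+1, ord0) in
  match nth Inc p q.1, val q.2 with
  | Emit b, _ => (next, Stay, None, Stay, Some b)
  | Inc, _ => (next, Stay, Some (Some true), MoveRight, None)
  | Load, 0%N => if b0 then (stay 0%N, MoveRight, Some (Some true), MoveRight, None)
                 else (stay 1%N, MoveLeft, None, Stay, None)
  | Load, _ => if b0 then (stay 1%N, MoveLeft, None, Stay, None)
               else (next, MoveRight, None, Stay, None)
  | Flush, 0%N => (stay 1%N, Stay, None, MoveLeft, None)
  | Flush, _ => if b1 then (stay 1%N, Stay, Some None, MoveLeft, Some true)
                else (next, Stay, None, MoveRight, None)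
  | Tri, 0%N => (stay 1%N, Stay, None, MoveLeft, None)
  | Tri, 1%N => if b1 then (stay 1%N, Stay, None, MoveLeft, Some true)
                else (stay 2%N, Stay, None, MoveRight, None)
  | Tri, 2%N => if b1 then (stay 2%N, Stay, None, MoveRight, None)
                else (stay 3%N, Stay, None, MoveLeft, None)
  | Tri, _ => if b1 then (stay 0%N, Stay, Some None, Stay, Some false)
              else (next, Stay, None, MoveRight, None)
  end.

Definition script_delta (q : script_state) (r : {ffun 'I_3 -> option bool}) :
    script_state * ('I_3 -> option bool * move) :=
  let: (q', m0, w1, m1, e) := script_action q (r ord0) (r (@Ordinal 3 1 isT)) in
  (q', fun i => match val i with
    | 0%N => (r i, m0)
    | 1%N => (if w1 is Some w then w else r i, m1)
    | _ => if e is Some b then (Some b, MoveRight) else (r i, Stay)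
    end).

Definition script_machine : turing_machine :=
  @TuringMachine 2 script_state (ord0, ord0) (fun q => val q.1 == size p) script_delta.

Section Run.
Variable s : seq bool.

Definition script_conf (q : script_state) (h0 : int) (k : nat) (h1 : int)
    (out : seq bool) : tm_config script_machine :=
  @TMConfig script_machine q
    (fun i : 'I_3 => match val i with 0%N => h0 | 1%N => h1 | _ => (Posz (size out)) end)
    (fun i : 'I_3 => match val i with 0%N => tape_of s
      | 1%N => tape_of (nseq k true) | _ => tape_of out end).

(** Reduces a machine step to its effect on the state, the heads, the counter value and the output.
    The last hypothesis says that the counter tape still holds a unary number after the write. *)
Lemma script_step q h0 k h1 out q' m0 w1 m1 e k' :
  (val q.1 < size p)%N ->
  script_action q (tape_of s h0) (tape_of (nseq k true) h1) = (q', m0, w1, m1, e) ->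
  (forall z, (if z == h1 then if w1 is Some w then w else tape_of (nseq k true) h1
     else tape_of (nseq k true) z) = tape_of (nseq k' true) z) ->
  tm_step (script_conf q h0 k h1 out)
  = script_conf q' (move_head h0 m0) k' (move_head h1 m1)
      (if e is Some b then rcons out b else out).
Proof.
move=> qp act wr; rewrite /tm_step /= (ltn_eqF qp) /script_delta /= !ffunE /= act.
rewrite /script_conf; congr TMConfig; apply/funext => -[[|[|[|//]]] lt] /=.
- by [].
- by [].
- by case: e {act} => //= b; rewrite size_rcons; lia.
- by rewrite ffunE /=; apply/funext => z; case: eqP => // ->.
- by apply/funext => z; rewrite ffunE /= -wr.
- apply/funext => z; case: e {act} => [b|]; last by rewrite ffunE /=; case: eqP => // ->.
  case: z => z //=; rewrite -cats1 onth_cat eqz_nat.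
  case: ltngtP => // [h|->]; last by rewrite subnn.
  by rewrite [onth [:: _] _]onth_default ?onth_default //= ?(ltnW h) // subn_gt0.
Qed.

Lemma tape_of_nseq k z :
  tape_of (nseq k true) z = if (0 <= z < (Posz k))%R then Some true else None.
Proof. by case: z => z //=; rewrite onth_nseq. Qed.

Lemma tape_of_size z : isSome (tape_of s z) = (0 <= z < (Posz (size s)))%R.
Proof. by case: z => z //=; rewrite onthTE. Qed.

Lemma tape_of_true k z : isSome (tape_of (nseq k true) z) = (0 <= z < (Posz k))%R.
Proof. by rewrite tape_of_nseq; case: ifP. Qed.

Lemma inord4 (a : nat) : (a < 4)%N -> val (inord a : 'I_4) = a.
Proof. exact: inordK. Qed.

Local Arguments tape_of : simpl never.

Local Notation steps := (fun t => iter t (@tm_step script_machine)).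

Lemma stepsD a b x : steps (a + b)%N x = steps b (steps a x).
Proof. by rewrite addnC iterD. Qed.

Lemma run_command (a : 'I_(size p).+1) (c : command) k out
    (r := exec_command (size s) c (k, out)) :
  (a < size p)%N -> nth Inc p a = c ->
  steps (command_cost (size s) c k) (script_conf (a, ord0) 0%R k (Posz k) out)
  = script_conf (inord a.+1, ord0) 0%R r.1 (Posz r.1) r.2.
Proof.
move=> lt.
have i0 : (inord 0 : 'I_4) = ord0 by apply/val_inj; rewrite /= inord4.
have act := (tape_of_size, tape_of_true, inord4).
case: c @r => [b||||] /= def_c.
- rewrite /= (script_step (q' := (inord a.+1, ord0)) (m0 := Stay) (w1 := None)
    (m1 := Stay) (e := Some b) (k' := k) _ _ _) //=; last by move=> z; case: eqP => // ->.
  by rewrite /script_action /= def_c.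
- have up j : (j <= size s)%N ->
      steps j (script_conf (a, ord0) 0%R k (Posz k) out)
      = script_conf (a, ord0) (Posz j) (k + j) (Posz (k + j)%N) out.
    elim: j => [|j IHj] jn; first by rewrite /= addn0.
    rewrite iterS IHj 1?ltnW //.
    rewrite (script_step (q' := (a, ord0)) (m0 := MoveRight) (w1 := Some (Some true))
      (m1 := MoveRight) (e := None) (k' := (k + j.+1)%N) _ _ _) //=.
    + by congr script_conf; lia.
    + rewrite /script_action /= def_c !act //= i0.
      by rewrite (_ : (_ < _)%R = true) //; lia.
    + move=> z; rewrite !tape_of_nseq; case: eqP => [->|ne].
        by rewrite ifT //; lia.
      by congr (if _ then _ else _); apply/idP/idP; lia.
  (* The input head runs back to cell -1, the first blank on the left; the exit step then puts it on
     cell 0. *)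
  have down j : (j <= size s)%N ->
      steps j (script_conf (a, inord 1) (Posz (size s) - 1)%R (k + size s)
        (Posz (k + size s)%N) out)
      = script_conf (a, inord 1) (Posz (size s) - 1 - Posz j)%R (k + size s)
        (Posz (k + size s)%N) out.
    elim: j => [|j IHj] jn; first by rewrite /= subr0.
    rewrite iterS IHj 1?ltnW //.
    rewrite (script_step (q' := (a, inord 1)) (m0 := MoveLeft) (w1 := None)
      (m1 := Stay) (e := None) (k' := (k + size s)%N) _ _ _) //=.
    + by congr script_conf; lia.
    + rewrite /script_action /= def_c !act //=.
      by rewrite (_ : (_ && _) = true) //; lia.
    + by move=> z; case: eqP => // ->.
  rewrite stepsD up // iterSr.
  rewrite (script_step (q' := (a, inord 1)) (m0 := MoveLeft) (w1 := None)
      (m1 := Stay) (e := None) (k' := (k + size s)%N) _ _ _) //=; first last.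
  + by move=> z; case: eqP => // ->.
  + rewrite /script_action /= def_c !act //=.
    by rewrite (_ : (_ < _)%R = false) //; lia.
  rewrite down // (script_step (q' := (inord a.+1, ord0)) (m0 := MoveRight) (w1 := None)
      (m1 := Stay) (e := None) (k' := (k + size s)%N) _ _ _) //=; first last.
  + by move=> z; case: eqP => // ->.
  + rewrite /script_action /= def_c !act //=.
    by rewrite (_ : (_ && _) = false) //; lia.
  by congr script_conf; lia.
- rewrite /= (script_step (q' := (inord a.+1, ord0)) (m0 := Stay) (w1 := Some (Some true))
    (m1 := MoveRight) (e := None) (k' := k.+1) _ _ _) //=.
  + by congr script_conf; lia.
  + by rewrite /script_action /= def_c.
  + move=> z; rewrite -[true :: _]/(nseq k.+1 true) !tape_of_nseq; case: eqP => [->|ne].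
      by rewrite ifT //; lia.
    by congr (if _ then _ else _); apply/idP/idP; lia.
- have sweep j : (j <= k)%N ->
      steps j (script_conf (a, inord 1) 0%R k ((Posz k) - 1)%R out)
      = script_conf (a, inord 1) 0%R (k - j) ((Posz k) - 1 - (Posz j))%R (out ++ nseq j true).
    elim: j => [|j IHj] jn; first by rewrite /= subr0 subn0 cats0.
    rewrite iterS IHj 1?ltnW //.
    rewrite (script_step (q' := (a, inord 1)) (m0 := Stay) (w1 := Some None)
      (m1 := MoveLeft) (e := Some true) (k' := (k - j.+1)%N) _ _ _) //=.
    + congr script_conf; first lia.
      by rewrite rcons_cat rcons_nseq.
    + rewrite /script_action /= def_c !act //=.
      by rewrite (_ : (_ && _) = true) //; lia.
    + move=> z; rewrite !tape_of_nseq; case: eqP => [->|ne].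
        by rewrite ifF //; lia.
      by congr (if _ then _ else _); apply/idP/idP; lia.
  rewrite -2!iterS iterSr.
  rewrite (script_step (q' := (a, inord 1)) (m0 := Stay) (w1 := None)
      (m1 := MoveLeft) (e := None) (k' := k) _ _ _) //=; first last.
  + by move=> z; case: eqP => // ->.
  + by rewrite /script_action /= def_c.
  rewrite sweep // subnn (script_step (q' := (inord a.+1, ord0)) (m0 := Stay) (w1 := None)
      (m1 := MoveRight) (e := None) (k' := 0%N) _ _ _) //=; first last.
  + by move=> z; case: eqP => // ->.
  + rewrite /script_action /= def_c -[[::]]/(nseq 0 true) !act //=.
    by rewrite (_ : (_ && _) = false) //; lia.
  by congr script_conf; lia.
- have left j o l : (j <= l)%N ->
      steps j (script_conf (a, inord 1) 0%R l ((Posz l) - 1)%R o)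
      = script_conf (a, inord 1) 0%R l ((Posz l) - 1 - (Posz j))%R (o ++ nseq j true).
    elim: j => [|j IHj] jn; first by rewrite /= subr0 cats0.
    rewrite iterS IHj 1?ltnW //.
    rewrite (script_step (q' := (a, inord 1)) (m0 := Stay) (w1 := None)
      (m1 := MoveLeft) (e := Some true) (k' := l) _ _ _) //=.
    + congr script_conf; first lia.
      by rewrite rcons_cat rcons_nseq.
    + rewrite /script_action /= def_c !act //=.
      by rewrite (_ : (_ && _) = true) //; lia.
    + by move=> z; case: eqP => // ->.
  have right j o l : (j <= l)%N ->
      steps j (script_conf (a, inord 2) 0%R l 0%R o)
      = script_conf (a, inord 2) 0%R l (Posz j) o.
    elim: j => [|j IHj] jn; first by [].
    rewrite iterS IHj 1?ltnW //.
    rewrite (script_step (q' := (a, inord 2)) (m0 := Stay) (w1 := None)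
      (m1 := MoveRight) (e := None) (k' := l) _ _ _) //=.
    + by congr script_conf; lia.
    + rewrite /script_action /= def_c !act //=.
      by rewrite (_ : (_ < _)%R = true) //; lia.
    + by move=> z; case: eqP => // ->.
  (* One row of the triangle: the left sweep emits the marks, and the silent right sweep returns to
     the last mark, the one to be erased. *)
  have round l o : steps (l + l + 3)%N (script_conf (a, ord0) 0%R l (Posz l) o)
      = script_conf (a, inord 3) 0%R l ((Posz l) - 1)%R (o ++ nseq l true).
    rewrite (_ : l + l + 3 = 1 + (l.+1 + l.+1))%N; last lia.
    rewrite stepsD /=.
    rewrite (script_step (q' := (a, inord 1)) (m0 := Stay) (w1 := None)
        (m1 := MoveLeft) (e := None) (k' := l) _ _ _) //=; first last.
    + by move=> z; case: eqP => // ->.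
    + by rewrite /script_action /= def_c.
    rewrite stepsD left // iterSr.
    rewrite (script_step (q' := (a, inord 2)) (m0 := Stay) (w1 := None)
        (m1 := MoveRight) (e := None) (k' := l) _ _ _) //=; first last.
    + by move=> z; case: eqP => // ->.
    + rewrite /script_action /= def_c !act //=.
      by rewrite (_ : (_ && _) = false) //; lia.
    rewrite (_ : (_ - _ + 1)%R = 0%R); last lia.
    rewrite right //.
    rewrite (script_step (q' := (a, inord 3)) (m0 := Stay) (w1 := None)
        (m1 := MoveLeft) (e := None) (k' := l) _ _ _) //=; first last.
    + by move=> z; case: eqP => // ->.
    + rewrite /script_action /= def_c !act //=.
      by rewrite (_ : (_ < _)%R = false) //; lia.
  elim: k out => [|k IHk] out.
    rewrite (_ : 0 * _ + 4 = 0 + 0 + 3 + 1)%N // stepsD round /=.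
    rewrite (script_step (q' := (inord a.+1, ord0)) (m0 := Stay) (w1 := None)
        (m1 := MoveRight) (e := None) (k' := 0%N) _ _ _) //=; first last.
    + by move=> z; case: eqP => // ->.
    + by rewrite /script_action /= def_c !act.
  rewrite (_ : _ + 4 = k.+1 + k.+1 + 3 + (1 + (k * (k + 5) + 4)))%N; last first.
    by rewrite mulSn !mulnDr mulnS; lia.
  rewrite stepsD round stepsD /=.
  rewrite (script_step (q' := (a, ord0)) (m0 := Stay) (w1 := Some None)
        (m1 := Stay) (e := Some false) (k' := k) _ _ _) //=; first last.
  + move=> z; rewrite -[true :: _]/(nseq k.+1 true) !tape_of_nseq; case: eqP => [->|ne].
      by rewrite ifF //; lia.
    by congr (if _ then _ else _); apply/idP/idP; lia.
  + rewrite /script_action /= def_c -[true :: _]/(nseq k.+1 true) !act //= i0.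
    by rewrite (_ : (_ < _)%R = true) //; lia.
  rewrite (_ : (_ - 1)%R = Posz k); last lia.
  by rewrite IHk /= -!cats1 -!catA.
Qed.

Lemma run_script (a : nat) k out (r := exec (size s) (drop a p) (k, out)) :
  (a <= size p)%N ->
  steps (exec_cost (size s) (drop a p) (k, out)) (script_conf (inord a, ord0) 0%R k (Posz k) out)
  = script_conf (inord (size p), ord0) 0%R r.1 (Posz r.1) r.2.
Proof.
move def_d : (size p - a)%N => d.
elim: d a k out @r def_d => [|d IHd] a k out /= def_d ap.
  have -> : a = size p by lia.
  by rewrite drop_size.
have lt : (a < size p)%N by lia.
rewrite (drop_nth Inc) //= stepsD.
have e : (inord a : 'I_(size p).+1) = a :> nat by rewrite inordK // ltnS ltnW.
rewrite (run_command (c := nth Inc p a)) ?e //.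
rewrite [exec_command (size s) (nth Inc p a) (k, out)]surjective_pairing /= IHd //; lia.
Qed.

End Run.

(** The induction needs an arbitrary bound [K] on the initial counter: a command raises the counter
    by at most [n + 1], whence [K + 'X + 1] for the remaining script. *)
Lemma exec_cost_poly (K : {poly nat}) (q : seq command) :
  exists P : {poly nat}, forall n r, (r.1 <= K.[n]%R)%N -> (exec_cost n q r <= P.[n]%R)%N.
Proof.
elim: q K => [|c q IHq] K; first by exists 0%R => n r _; rewrite /= horner0.
have [P HP] := IHq (K + 'X + 1)%R.
exists (P + ('X + 'X + 2%:P + K * (K + 5%:P) + 4%:P))%R => n r Kr /=.
rewrite addnC hornerD; apply: leq_add.
  apply: HP; rewrite !hornerD hornerX hornerC.
  by case: c => [b||||] /=; lia.
rewrite !hornerD hornerM !hornerD !hornerC hornerX.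
have := leq_mul Kr (leq_add Kr (leqnn 5)).
rewrite -[X in _ -> (_ <= X)%N]/(n + n + 2 + K.[n]%R * (K.[n]%R + 5) + 4)%N.
by case: c => [b||||] /=; lia.
Qed.

Lemma iter_halt (M : turing_machine) (c : tm_config M) t :
  tm_halt (cfg_state c) -> iter t (@tm_step M) c = c.
Proof. by move=> h; elim: t => //= t ->; rewrite /tm_step h. Qed.

Lemma polytime_exec (S T : Type) (eS : S -> seq bool) (eT : T -> seq bool) (f : S -> T) :
  (forall s, eT (f s) = (exec (size (eS s)) p (0%N, [::])).2) -> polytime eS eT f.
Proof.
move=> fE; have [P HP] := exec_cost_poly 0%R p.
exists script_machine, P => s; rewrite /tm_outputs.
have init : tm_init script_machine (eS s) = script_conf (eS s) (inord 0, ord0) 0%R 0 (Posz 0) [::].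
  rewrite /tm_init /script_conf; congr TMConfig.
  - by congr pair; apply/val_inj; rewrite /= inordK.
  - by apply/funext => -[[|[|[|//]]] lt].
  - by apply/funext => -[[|[|[|//]]] lt] //=; apply/funext; case=> // -[].
have := run_script (eS s) (a := 0) 0 [::] isT; rewrite drop0 -init => run.
rewrite -(subnKC (HP (size (eS s)) (0%N, [::]) _)); last by rewrite horner0.
rewrite stepsD run iter_halt /=; last by rewrite inordK.
by rewrite inordK // fE.
Qed.

End ScriptMachine.

(** * Enumeration of polynomial-time functions *)

Definition move_of_code (o : option bool) : move :=
  match o with None => Stay | Some false => MoveLeft | Some true => MoveRight end.

Definition code_of_move (m : move) : option bool :=
  match m with Stay => None | MoveLeft => Some false | MoveRight => Some true end.

Lemma code_of_moveK : cancel code_of_move move_of_code.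
Proof. by case. Qed.

(** States become ordinals and transitions finite functions, with moves coded by [option bool], so
    that the tables of given dimensions form a countable type. *)
Definition tm_table (k m : nat) : countType :=
  ('I_m * {ffun 'I_m -> bool} *
   {ffun 'I_m * {ffun 'I_k.+1 -> option bool} ->
     'I_m * {ffun 'I_k.+1 -> option bool * option bool}})%type.

Definition tm_of_table (k m : nat) (b : tm_table k m) : turing_machine :=
  @TuringMachine k 'I_m b.1.1 (fun q => b.1.2 q)
    (fun q r => let d := b.2 (q, r) in
       (d.1, fun i => ((d.2 i).1, move_of_code (d.2 i).2))).

(** Renumbering the states by [enum_rank] commutes with the steps and leaves heads and tapes
    unchanged. *)
Lemma tm_table_complete (M : turing_machine) :
  exists b : tm_table (tm_tapes M) #|{: tm_state M}|, forall s t out,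
    tm_outputs M s t out <-> tm_outputs (tm_of_table b) s t out.
Proof.
pose b : tm_table (tm_tapes M) #|{: tm_state M}| :=
  (enum_rank (tm_start M), [ffun q => tm_halt (enum_val q)],
   [ffun qr => let d := tm_delta (enum_val qr.1) qr.2 in
     (enum_rank d.1, [ffun i => ((d.2 i).1, code_of_move (d.2 i).2)])]).
exists b => s t out.
pose phi (c : tm_config M) : tm_config (tm_of_table b) :=
  @TMConfig (tm_of_table b) (enum_rank (cfg_state c)) (cfg_head c) (cfg_tape c).
have phi_step c : tm_step (phi c) = phi (tm_step c).
  rewrite /tm_step /= ffunE enum_rankK; case: ifP => //= _.
  rewrite /phi /= ffunE /= enum_rankK; congr TMConfig.
    by apply/funext => i; rewrite ffunE /= code_of_moveK.
  by apply/funext => i; apply/funext => z; rewrite ffunE.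
have init : tm_init (tm_of_table b) s = phi (tm_init M s) by [].
rewrite /tm_outputs init.
have -> : iter t (@tm_step (tm_of_table b)) (phi (tm_init M s))
    = phi (iter t (@tm_step M) (tm_init M s)).
  by elim: t => //= t ->; rewrite phi_step.
by rewrite /= ffunE enum_rankK.
Qed.

(** A head advances by at most one cell per step, so after [t] steps all cells from [t + size s] on
    are still blank. *)
Lemma tm_outputs_size (M : turing_machine) s t out :
  tm_outputs M s t out -> (size out <= t + size s)%N.
Proof.
case=> _ outE; rewrite -onthNE -outE.
suff [_ ->] : (forall i, cfg_head (iter t (@tm_step M) (tm_init M s)) i <= Posz t)%R /\
  (forall i z, (Posz (t + size s) <= z)%R ->
     cfg_tape (iter t (@tm_step M) (tm_init M s)) i z = None) by [].
elim: t {out outE} => [|t [IHh IHt]] /=.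
  split=> // i z zs; case: (i == ord0) => //; case: z zs => //= z zs.
  by rewrite onth_default.
move: (iter t _ _) IHh IHt => c IHh IHt.
rewrite /tm_step; case: ifP => _ /=; split=> i.
- by apply: le_trans (IHh i) _; lia.
- by move=> z zs; apply: IHt; lia.
- by have := IHh i; case: (_.2 i).2 => /=; lia.
- move=> z zs; rewrite ifF; first by apply: IHt; lia.
  by apply/eqP => zE; have := IHh i; lia.
Qed.

(** Unique decoding in front of arbitrary continuations, the form that composes along
    concatenations. *)
Definition prefix_free (T : Type) (e : T -> seq bool) :=
  forall x y s t, e x ++ s = e y ++ t -> x = y /\ s = t.

Lemma prefix_freeA (T : Type) (e : T -> seq bool) x y u v s t :
  prefix_free e -> (e x ++ u) ++ s = (e y ++ v) ++ t -> x = y /\ u ++ s = v ++ t.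
Proof. by move=> epf; rewrite -!catA; apply: epf. Qed.

Lemma enc_nat_prefix_free : prefix_free enc_nat.
Proof.
elim=> [|x IHx] [|y] s t //; first by case.
by rewrite /enc_nat /= => -[] /IHx [-> ->].
Qed.

Lemma enc_seq_cons (T : Type) (e : T -> seq bool) x r :
  enc_seq e (x :: r) = true :: e x ++ enc_seq e r.
Proof. by rewrite /enc_seq /= catA. Qed.

Lemma enc_seq_prefix_free (T : Type) (e : T -> seq bool) :
  prefix_free e -> prefix_free (enc_seq e).
Proof.
move=> epf; elim=> [|x a IHa] [|y b] s t; rewrite ?enc_seq_cons //=; first by case.
by case=> /(prefix_freeA epf) [-> /IHa [-> ->]].
Qed.

Lemma enc_gate_prefix_free : prefix_free enc_gate.
Proof.
have pf := enc_nat_prefix_free; have spf := enc_seq_prefix_free pf.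
have pfA := @prefix_freeA _ _ _ _ _ _ _ _ pf.
case=> [i|i|i j|i j k|n ws] [i'|i'|i' j'|i' j' k'|n' ws'] s t;
  rewrite /enc_gate => /pfA [] // _.
- by move/pf => [-> ->].
- by move/pf => [-> ->].
- by move/pfA => [-> /pf [-> ->]].
- by move/pfA => [-> /pfA [-> /pf [-> ->]]].
- by move/pfA => [-> /spf [-> ->]].
Qed.

(** Makes a verifier a function of the code of its machine: the output tape determines the
    circuit. *)
Lemma enc_algorithm_inj : injective enc_algorithm.
Proof.
move=> [n c] [n' c']; rewrite /enc_algorithm => /enc_nat_prefix_free [/= -> eq_c].
have [|-> _] // := enc_seq_prefix_free enc_gate_prefix_free (x := c) (y := c') (s := [::]) (t := [::]) _.
by rewrite !cats0.
Qed.

Definition calls_below (b : nat) (c : circuit) : bool :=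
  all (fun g => if g is Call n _ then (n < b)%N else true) c.

Lemma size_enc_nat n : size (enc_nat n) = n.+1.
Proof. by rewrite size_cat size_nseq addn1. Qed.

(** Naturals are written in unary, so the length of the encoding also bounds the indices of the
    calls. A verifier on a given input thus sees only finitely many oracle operations. *)
Lemma enc_circuit_bounds (c : circuit) b :
  (size (enc_circuit c) <= b)%N -> (size c <= b)%N /\ calls_below b c.
Proof.
elim: c b => [|g c IHc] b //; rewrite /enc_circuit enc_seq_cons /= size_cat => le_b.
have [|szc cb] := IHc b; first by move: le_b; rewrite /enc_circuit; lia.
have [szc' _] := IHc (size (enc_seq enc_gate c)) (leqnn _).
split; first lia.
rewrite /calls_below /= -/(calls_below b c) cb andbT.
have szg : if g is Call n _ then (n < size (enc_gate g))%N else true.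
  by case: g {le_b} => // n ws; rewrite /enc_gate size_cat [size (_ ++ enc_seq _ _)]size_cat !size_enc_nat; lia.
by case: g le_b szg => // n ws; move: (size (enc_gate _)) => m; lia.
Qed.

Lemma size_enc_pair x w : size (enc_pair (x, w)) = ((size x).*2.+1 + size w)%N.
Proof.
rewrite /enc_pair size_cat /=; congr (_ + _)%N.
by elim: x => // b x IHx; rewrite enc_seq_cons /= IHx.
Qed.

(** * Discrepancy *)

Section Discrepancy.
Variables (R : realFieldType) (Y : finType).
Local Open Scope ring_scope.

(* For each [y], averaging over the sign of [b y] leaves the sum unchanged, so
   some sign does not increase it. *)
Lemma signed_product_choice (B : seq {ffun Y -> R}) (w : {ffun Y -> R} -> R) (d : R)
    (s : seq Y) :
  uniq s -> exists sigma : Y -> bool,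
    \sum_(b <- B) w b * \prod_(y <- s) (1 + d * ((-1) ^+ sigma y * b y)) <= \sum_(b <- B) w b.
Proof.
elim: s w => [|y s IHs] w /=.
  by move=> _; exists (fun=> true); under eq_bigr do rewrite big_nil mulr1.
case/andP => ys us.
have [c le_c] : exists c : bool,
    \sum_(b <- B) w b * (1 + d * ((-1) ^+ c * b y)) <= \sum_(b <- B) w b.
  case: (lerP (\sum_(b <- B) w b * (1 + d * ((-1) ^+ true * b y))) (\sum_(b <- B) w b)) => [le|gt].
    by exists true.
  exists false; rewrite -subr_ge0; apply: ltW; move: gt; rewrite -subr_gt0 -!sumrB.
  congr (_ < _); apply: eq_bigr => b _; rewrite expr1 expr0; ring.
have [sigma le_sigma] := IHs (fun b => w b * (1 + d * ((-1) ^+ c * b y))) us.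
exists (fun z => if z == y then c else sigma z).
apply: le_trans le_c; apply: le_trans le_sigma; rewrite le_eqVlt; apply/orP; left; apply/eqP.
apply: eq_bigr => b _; rewrite big_cons eqxx mulrA; congr (_ * _).
rewrite !big_seq; apply: eq_bigr => z zs; case: eqP zs => // ->.
by rewrite (negPf ys).
Qed.

Lemma bernoulli (x : R) n : 0 <= x -> 1 + x *+ n <= (1 + x) ^+ n.
Proof.
move=> x0; elim: n => [|n IHn]; first by rewrite mulr0n addr0 expr0.
rewrite exprS; apply: le_trans (ler_wpM2l _ IHn); last by rewrite addr_ge0.
rewrite mulrS; have : 0 <= x * (x *+ n) by rewrite mulr_ge0 ?mulrn_wge0.
by lra.
Qed.

(* [2^L] bounds the product of the [1 + t y], whereas AM-GM bounds the product of
   the [1 - t y + x >= (1 + t y)^-1] by [(1 - x)^M < 2^-L]. *)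
Lemma sum_bound_of_product (e L : nat) (a : Y -> R) :
  (0 < e)%N -> (8 * e ^ 2 * L <= #|Y|)%N -> (forall y, `|a y| <= 1) ->
  \prod_y (1 + (4 * e)%:R^-1 * a y) < 2 ^+ L -> (\sum_y a y) * e%:R <= #|Y|%:R.
Proof.
move=> e0 le_Y a1 prodL; rewrite leNgt; apply/negP => sum_gt.
(* [x] is [2 / (4 * e) ^ 2], twice the largest possible square of [t y]. With [t y >= - 1 / 4] this
   gives [(1 + t y) * (1 - t y + x) >= 1]. *)
set M := #|Y|; pose x : R := (8 * e ^ 2)%:R^-1; pose t y := (4 * e)%:R^-1 * a y.
have e1 : 1 <= e%:R :> R by rewrite ler1n.
have e0' : 0 < e%:R :> R by apply: lt_le_trans e1.
have xE : x = 2 * ((4 * e)%:R^-1 * (4 * e)%:R^-1).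
  by rewrite /x !natrM; field; rewrite gt_eqF.
have d0 : 0 < (4 * e)%:R^-1 :> R by rewrite invr_gt0 natrM mulr_gt0.
have d4 : (4 * e)%:R^-1 <= 4^-1 :> R.
  by rewrite lef_pV2 ?posrE ?natrM ?mulr_gt0 // ler_peMr.
have x0 : 0 < x by rewrite xE !mulr_gt0.
have x1 : x <= 2^-1 by rewrite xE; nra.
have t2 y : t y * t y <= x / 2.
  have := a1 y; rewrite ler_norml => /andP[a_ge a_le].
  rewrite xE /t; have : a y * a y <= 1 by nra.
  have : 0 <= (4 * e)%:R^-1 * (4 * e)%:R^-1 :> R by rewrite mulr_ge0 // ltW.
  nra.
have t14 y : `|t y| <= 4^-1.
  rewrite normrM (ger0_norm (ltW d0)); apply: le_trans d4.
  by rewrite ler_piMr // ltW.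
have t_ge y : - 4^-1 <= t y by have := t14 y; rewrite ler_norml => /andP[].
have t_le y : t y <= 4^-1 by have := t14 y; rewrite ler_norml => /andP[].
have M0 : (0 < M)%N.
  rewrite lt0n; apply/eqP => M0; move: sum_gt; rewrite -/M M0 big1 ?mul0r ?ltxx //.
  by move=> y _; have := card0_eq M0 y; rewrite inE.
have M0' : 0 < M%:R :> R by rewrite ltr0n.
have prod1 : 1 <= \prod_y (1 + t y) * \prod_y (1 - t y + x).
  rewrite -big_split /=; elim/big_ind: _ => // [u v u1 v1|y _].
    by rewrite mulr_ege1.
  by have := t2 y; have := t_ge y; nra.
(* The mean of the [t y] exceeds [1 / (4 * e ^ 2) = 2 * x], so the mean of the factors is at most
   [1 - x]. *)
have agm : \prod_y (1 - t y + x) <= (1 - x) ^+ M.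
  have nn y : 0 <= 1 - t y + x by have := t_le y; lra.
  have [le_prod _] := @leif_AGM R Y predT (fun y => 1 - t y + x) (fun y _ => nn y).
  apply: le_trans le_prod _; rewrite -/M.
  have sum_nn : 0 <= \sum_(y in Y) (1 - t y + x) by apply: sumr_ge0.
  apply: lerXn2r; rewrite ?nnegrE ?divr_ge0 //; first lra.
  rewrite ler_pdivrMr // big_split sumrB /= !sumr_const -/M -mulr_sumr.
  rewrite -[1 *+ M]mulr_natr -[x *+ M]mulr_natr mul1r.
  suff : 2 * x * M%:R <= (4 * e)%:R^-1 * \sum_y a y by lra.
  rewrite xE -subr_ge0.
  have -> : (4 * e)%:R^-1 * (\sum_y a y) - 2 * (2 * ((4 * e)%:R^-1 * (4 * e)%:R^-1)) * M%:R
     = (4 * e)%:R^-1 * e%:R^-1 * ((\sum_y a y) * e%:R - M%:R) :> R.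
    by rewrite !natrM; field; rewrite gt_eqF.
  rewrite mulr_ge0 ?subr_ge0 1?ltW // mulr_gt0 // invr_gt0 //.
(* Since [8 * e ^ 2] is the inverse of [x], Bernoulli gives [2] as a lower bound for the power of
   [1 + x]; and [(1 - x) * (1 + x) <= 1]. *)
have half : (1 - x) ^+ (8 * e ^ 2) <= 2^-1.
  have two : 2 <= (1 + x) ^+ (8 * e ^ 2).
    have := bernoulli (8 * e ^ 2) (ltW x0).
    rewrite -[x *+ _]mulr_natr mulVf //.
    by rewrite pnatr_eq0 -lt0n muln_gt0 expn_gt0 e0.
  rewrite -[2^-1]mul1r ler_pdivlMr //.
  apply: le_trans (_ : (1 - x) ^+ (8 * e ^ 2) * (1 + x) ^+ (8 * e ^ 2) <= _).
    by apply: ler_wpM2l => //; apply: exprn_ge0; lra.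
  rewrite -exprMn -[X in _ <= X](expr1n R (8 * e ^ 2)).
  by apply: lerXn2r; rewrite ?nnegrE //; nra.
have small : (1 - x) ^+ M <= 2^-1 ^+ L.
  apply: le_trans (_ : (1 - x) ^+ (8 * e ^ 2 * L) <= _).
    by apply: ler_wiXn2l => //; lra.
  rewrite exprM; apply: lerXn2r; rewrite ?nnegrE ?exprn_ge0 //; lra.
have p0 : 0 <= \prod_y (1 + t y).
  by apply: prodr_ge0 => y _; have := t_ge y; lra.
have : \prod_y (1 + t y) * \prod_y (1 - t y + x) < 1.
  apply: le_lt_trans (_ : \prod_y (1 + t y) * 2^-1 ^+ L < _).
    by apply: ler_wpM2l => //; apply: le_trans small.
  by rewrite exprVn ltr_pdivrMr ?mul1r // exprn_gt0.
by rewrite ltNge prod1.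
Qed.

(** A derandomized union bound: the sum of the products over [B] starts at [size B] and never
    increases, so each product, being nonnegative, ends below [2 ^ L]. Closing [A] under negation
    turns the one-sided bound into a bound on the absolute value. *)
Lemma discrepancy (A : seq {ffun Y -> R}) (e L : nat) :
  (0 < e)%N -> (2 * size A < 2 ^ L)%N -> (8 * e ^ 2 * L <= #|Y|)%N ->
  (forall a, a \in A -> forall y, `|a y| <= 1) ->
  exists sigma : Y -> bool, forall a, a \in A ->
    `|\sum_y (-1) ^+ sigma y * a y| * e%:R <= #|Y|%:R.
Proof.
move=> e0 le_A le_Y A1.
pose opp (a : {ffun Y -> R}) := [ffun y => - a y]; pose B := A ++ map opp A.
have B1 b : b \in B -> forall y, `|b y| <= 1.
  rewrite mem_cat => /orP[/A1 //|/mapP[a /A1 a1 ->] y].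
  by rewrite ffunE normrN.
have [sigma le_sigma] := signed_product_choice B (fun=> 1) (4 * e)%:R^-1 (enum_uniq Y).
exists sigma => a aA.
have bound b : b \in B -> (\sum_y (-1) ^+ sigma y * b y) * e%:R <= #|Y|%:R.
  move=> bB; apply: (sum_bound_of_product e0 le_Y).
    by move=> y; rewrite normrM normrX normrN1 expr1n mul1r B1.
  apply: le_lt_trans (_ : (size B)%:R < _); last first.
    by rewrite -natrX ltr_nat size_cat size_map addnn -mul2n.
  apply: le_trans (_ : \sum_(b <- B) 1 <= _); last first.
    by rewrite big_const_seq count_predT iter_addr_0.
  apply: le_trans le_sigma; rewrite (perm_big _ (perm_to_rem bB)) /= big_cons mul1r.
  rewrite big_enum /= lerDl big_seq; apply: sumr_ge0 => c /mem_rem cB.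
  rewrite mul1r; apply: prodr_ge0 => y _.
  have : `|(4 * e)%:R^-1 * ((-1) ^+ sigma y * c y)| <= 1.
    rewrite !normrM normrX normrN1 expr1n mul1r mulr_ile1 ?B1 //.
    rewrite ger0_norm ?invr_ge0 ?ler0n // invf_le1 ?ler1n ?ltr0n ?muln_gt0 //.
  by rewrite ler_norml => /andP[]; lra.
have aB : a \in B by rewrite mem_cat aA.
have oB : opp a \in B by rewrite mem_cat map_f ?orbT.
have := bound _ oB; have := bound _ aB.
have -> : \sum_y (-1) ^+ sigma y * opp a y = - \sum_y (-1) ^+ sigma y * a y.
  by rewrite -sumrN; apply: eq_bigr => y _; rewrite ffunE mulrN.
move: (\sum_y _) => S ub lb.
by rewrite -[e%:R](@normr_nat R) -normrM ler_norml; apply/andP; split; lra.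
Qed.

End Discrepancy.

(** * Polynomial growth *)

(** The base is at least 2 for every [n], so constants and factors are absorbed by the exponent. *)
Definition poly_bounded (f : nat -> nat) : Prop :=
  exists d, forall n, (f n <= n.+2 ^ d)%N.

Lemma poly_bounded_const c : poly_bounded (fun=> c).
Proof.
exists c => n; apply: leq_trans (ltnW (ltn_expl c (isT : (1 < 2)%N))) _.
by case: c => // c; rewrite leq_exp2r.
Qed.

Lemma poly_bounded_id : poly_bounded id.
Proof. by exists 1%N => n; rewrite expn1; lia. Qed.

Lemma poly_boundedD f g :
  poly_bounded f -> poly_bounded g -> poly_bounded (fun n => f n + g n)%N.
Proof.
move=> [d fd] [d' gd]; exists (d + d').+1 => n; rewrite expnS.
apply: leq_trans (_ : 2 * n.+2 ^ (d + d') <= _)%N; last by rewrite leq_mul2r orbT.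
rewrite mul2n -addnn; apply: leq_add.
  by apply: leq_trans (fd n) _; rewrite leq_exp2l // leq_addr.
by apply: leq_trans (gd n) _; rewrite leq_exp2l // leq_addl.
Qed.

Lemma poly_boundedM f g :
  poly_bounded f -> poly_bounded g -> poly_bounded (fun n => f n * g n)%N.
Proof.
by move=> [d fd] [d' gd]; exists (d + d')%N => n; rewrite expnD leq_mul.
Qed.

Lemma poly_bounded_horner (p : {poly nat}) f :
  poly_bounded f -> poly_bounded (fun n => p.[f n]%R).
Proof.
move=> pf; elim/poly_ind: p => [|p c IHp].
  by exists 0%N => n; rewrite horner0.
have [d le_d] := poly_boundedD (poly_boundedM IHp pf) (poly_bounded_const c).
by exists d => n; rewrite hornerMXaddC.
Qed.

Lemma leq_horner (p : {poly nat}) a b : (a <= b)%N -> (p.[a]%R <= p.[b]%R)%N.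
Proof.
move=> ab; elim/poly_ind: p => [|p c IHp]; first by rewrite !horner0.
by rewrite !hornerMXaddC leq_add2r; apply: leq_mul.
Qed.

(** Taking [n = 2 ^ t] gives [n + 2 <= 2 ^ t.+1], which leaves [t.+1 * d <= 2 ^ t]. With [t = 2 * s]
    and [s >= 2 * d] this follows from [(s + 1) ^ 2 <= 2 ^ t]. *)
Lemma exp2_eventually_large d N : exists2 n, (N <= n)%N & (n.+2 ^ d <= 2 ^ n)%N.
Proof.
pose s := (2 * d + N + 1)%N; pose t := (s + s)%N.
have big m : (m < 2 ^ m)%N := ltn_expl m (isT : (1 < 2)%N).
exists (2 ^ t)%N; first by have := big t; rewrite /t /s; lia.
apply: leq_trans (_ : (2 ^ t.+1) ^ d <= _)%N.
  have e1 : (2 < 2 ^ t)%N by have := big t; rewrite /t /s; lia.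
  have mono k a b : (a <= b)%N -> (a ^ k <= b ^ k)%N by case: k => // k; rewrite leq_exp2r.
  by apply: mono; rewrite expnS; lia.
rewrite -expnM leq_exp2l // [X in (_ <= X)%N]expnD.
have := leq_mul (big s) (big s); rewrite /t /s; nia.
Qed.

(** * Operators on qubits *)

Section Operators.
Variable R : realType.
Local Open Scope ring_scope.
Local Open Scope sesquilinear_scope.
Local Notation C := R[i].

Section Entries.
Variable k : nat.
Implicit Types (A B : qop R k) (x y : k.-tuple bool).

Lemma entryE f x y : entry (mkop f : qop R k) x y = f x y.
Proof. by rewrite /entry mxE !enum_rankK. Qed.

Lemma entry_inj A B : (forall x y, entry A x y = entry B x y) -> A = B.
Proof.
by move=> AB; apply/matrixP => i j; rewrite -(enum_valK i) -(enum_valK j); apply: AB.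
Qed.

Lemma entry_mul A B x y : entry (A *m B) x y = \sum_z entry A x z * entry B z y.
Proof.
rewrite /entry mxE (reindex (@enum_rank {: k.-tuple bool})) //=.
exact/onW_bij/enum_rank_bij.
Qed.

Lemma entry_adj A x y : entry (A^t*) x y = (entry A y x)^*.
Proof. by rewrite /entry !mxE. Qed.

Lemma entry_scale c A x y : entry (c *: A) x y = c * entry A x y.
Proof. by rewrite /entry mxE. Qed.

Lemma entry_sum I (r : seq I) (P : pred I) (F : I -> qop R k) x y :
  entry (\sum_(i <- r | P i) F i) x y = \sum_(i <- r | P i) entry (F i) x y.
Proof. by rewrite /entry summxE. Qed.

Lemma entry_id x y : entry (1%:M : qop R k) x y = (x == y)%:R.
Proof. by rewrite /entry mxE (inj_eq enum_rank_inj). Qed.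

Lemma trace_entry A : \tr A = \sum_x entry A x x.
Proof.
rewrite /entry /mxtrace (reindex (@enum_rank {: k.-tuple bool})) //=.
exact/onW_bij/enum_rank_bij.
Qed.

End Entries.

Definition good_wires (N k : nat) (ws : seq nat) : bool :=
  [&& uniq ws, all (fun w => w < N)%N ws & size ws == k].

(** The test in the definition of [lift_op]: equality off the wires [ws]. *)
Definition agree (N : nat) (ws : seq nat) (x y : N.-tuple bool) : bool :=
  [forall i : 'I_N, (val i \notin ws) ==> (tnth x i == tnth y i)].

Definition write_wires (N k : nat) (ws : seq nat) (x : N.-tuple bool) (u : k.-tuple bool) :
    N.-tuple bool :=
  [tuple if val i \in ws then nth false u (index (val i) ws) else tnth x i | i < N].

Lemma agreeP (N : nat) ws (x y : N.-tuple bool) :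
  reflect (forall i : 'I_N, val i \notin ws -> tnth x i = tnth y i) (agree ws x y).
Proof.
apply: (iffP forallP) => [xy i iws|xy i]; last by apply/implyP => /xy ->.
by apply/eqP; have /implyP := xy i; apply.
Qed.

Lemma agreexx (N : nat) ws (x : N.-tuple bool) : agree ws x x.
Proof. exact/agreeP. Qed.

Lemma agree_sym (N : nat) ws (x y : N.-tuple bool) : agree ws x y = agree ws y x.
Proof. by apply/agreeP/agreeP => h i /h. Qed.

Lemma agree_trans (N : nat) ws (x y z : N.-tuple bool) :
  agree ws x y -> agree ws x z = agree ws y z.
Proof.
by move/agreeP => xy; apply/agreeP/agreeP => h i iws; rewrite -h // xy.
Qed.

Section Lifting.
Variables (N k : nat) (ws : seq nat).
Hypothesis ok : good_wires N k ws.
Implicit Types (x y z : N.-tuple bool) (u : k.-tuple bool) (K : qop R k).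

Lemma agree_write x u : agree ws x (write_wires ws x u).
Proof. by apply/agreeP => i iws; rewrite tnth_mktuple (negPf iws). Qed.

Lemma read_write x u : read_wires k ws (write_wires ws x u) = u.
Proof.
case/and3P: ok => uws /allP wsN /eqP szw.
apply: eq_from_tnth => i; rewrite tnth_mktuple.
have iw : nth 0%N ws i \in ws by rewrite mem_nth // szw.
rewrite -[nth 0%N ws i]/(val (Ordinal (wsN _ iw))) -tnth_nth tnth_mktuple /= iw.
by rewrite index_uniq ?szw // (tnth_nth false).
Qed.

Lemma write_read x z : agree ws x z -> write_wires ws x (read_wires k ws z) = z.
Proof.
case/and3P: ok => uws _ /eqP szw.
move/agreeP => xz; apply: eq_from_tnth => i; rewrite tnth_mktuple.
case: ifP => [iw|/negbT /xz //].
have lt : (index (val i) ws < k)%N by rewrite -szw index_mem.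
rewrite -[index _ _]/(val (Ordinal lt)) -tnth_nth tnth_mktuple /= nth_index //.
by rewrite (tnth_nth false).
Qed.

(** Strings that agree with [x] off [ws] are parametrized by their values on [ws], so sums over the
    register reduce to sums over [k] bits. *)
Lemma sum_agree (V : nmodType) x (F : N.-tuple bool -> V) :
  \sum_(z | agree ws x z) F z = \sum_u F (write_wires ws x (u : k.-tuple bool)).
Proof.
rewrite (reindex_onto (write_wires (k := k) ws x) (read_wires k ws)) => [|z xz]; last exact: write_read.
by apply: eq_bigl => u; rewrite agree_write read_write eqxx.
Qed.

Lemma agree_read_inj x y :
  agree ws x y -> read_wires k ws x = read_wires k ws y -> x = y.
Proof.
by move=> xy rxy; rewrite -(write_read xy) -rxy write_read // agreexx.
Qed.

Lemma entry_lift K x y :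
  entry (lift_op N ws K) x y =
  if agree ws x y then entry K (read_wires k ws x) (read_wires k ws y) else 0.
Proof. exact: entryE. Qed.

(** This and the next three lemmas make lifting a unital star-homomorphism, so that completeness and
    unitarity relations pass to the whole register. *)
Lemma lift_mul K K' : lift_op N ws (K *m K') = lift_op N ws K *m lift_op N ws K'.
Proof.
apply: entry_inj => x y; rewrite entry_mul entry_lift.
transitivity (\sum_(z | agree ws x z)
    entry K (read_wires k ws x) (read_wires k ws z) * entry (lift_op N ws K') z y).
  rewrite sum_agree; case: ifP => xy; last first.
    rewrite big1 // => u _; rewrite entry_lift.
    by rewrite -(agree_trans y (agree_write x u)) xy mulr0.
  rewrite entry_mul; apply: eq_bigr => u _.
  by rewrite entry_lift -(agree_trans y (agree_write x u)) xy read_write.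
rewrite big_mkcond /=; apply: eq_bigr => z _; rewrite [in RHS]entry_lift.
by case: ifP => // _; rewrite mul0r.
Qed.

Lemma lift_adj K : lift_op N ws (K^t*) = (lift_op N ws K)^t*.
Proof.
apply: entry_inj => x y; rewrite entry_adj !entry_lift agree_sym entry_adj.
by case: ifP => // _; rewrite conjC0.
Qed.

Lemma lift_id : lift_op N ws (1%:M : qop R k) = 1%:M.
Proof.
apply: entry_inj => x y; rewrite entry_lift !entry_id.
case: (boolP (agree ws x y)) => [xy|nxy].
  congr (_%:R); congr nat_of_bool; apply/eqP/eqP => [|-> //].
  exact: agree_read_inj.
by case: eqP nxy => // ->; rewrite agreexx.
Qed.

Lemma lift_sum I (r : seq I) (F : I -> qop R k) :
  lift_op N ws (\sum_(i <- r) F i) = \sum_(i <- r) lift_op N ws (F i).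
Proof.
apply: entry_inj => x y; rewrite entry_lift !entry_sum; case: ifP => xy.
  by apply: eq_bigr => i _; rewrite entry_lift xy.
by rewrite big1 // => i _; rewrite entry_lift xy.
Qed.

End Lifting.

(** * Density operators *)

(** In [R[i]], [0 <=] includes being real, so this forces [rho] to be hermitian. *)
Definition psd (k : nat) (rho : qop R k) : Prop :=
  forall v : 'rV_#|{: k.-tuple bool}|, 0 <= (v *m rho *m v^t*) 0 0.

Definition density (k : nat) (rho : qop R k) : Prop := psd rho /\ \tr rho = 1.

Lemma psd_conj k (rho K : qop R k) : psd rho -> psd (K *m rho *m K^t*).
Proof.
move=> rho0 v; have := rho0 (v *m K).
by rewrite trmx_mul map_mxM !mulmxA.
Qed.

Lemma psd_sum k I (r : seq I) (F : I -> qop R k) :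
  (forall i, psd (F i)) -> psd (\sum_(i <- r) F i).
Proof.
move=> F0 v; rewrite mulmx_sumr mulmx_suml summxE.
by apply: sumr_ge0 => i _; apply: F0.
Qed.

Lemma entry_zero_state N (x y : N.-tuple bool) (z := nseq_tuple N false) :
  entry (zero_state R N) x y = ((x == z) && (y == z))%:R.
Proof. exact: entryE. Qed.

Lemma psd_zero_state N : psd (zero_state R N).
Proof.
pose z := nseq_tuple N false.
have -> : zero_state R N = delta_mx (enum_rank z) 0 *m (delta_mx (enum_rank z) 0 : 'cV_ _)^t*.
  apply: entry_inj => x y; rewrite entry_zero_state -/z /entry mxE big_ord1 !mxE !eqxx !andbT.
  rewrite !(inj_eq enum_rank_inj); case: (x == z); case: (y == z);
  by rewrite ?conjC1 ?conjC0 ?mulr1 ?mulr0.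
move=> v; rewrite mulmxA -mulmxA -[X in _ *m X]map_mxM -trmx_mul /=.
by rewrite mxE big_ord1 !mxE mul_conjC_ge0.
Qed.

Lemma psd_diag k (rho : qop R k) x : psd rho -> 0 <= entry rho x x.
Proof.
move=> /(_ (delta_mx 0 (enum_rank x))); rewrite -rowE.
suff -> : (row (enum_rank x) rho *m
    (delta_mx 0 (enum_rank x) : 'rV_#|{: k.-tuple bool}|)^t*) 0 0 = entry rho x x by [].
rewrite mxE (bigD1 (enum_rank x)) //= !mxE !eqxx /= conjC1 mulr1 big1 ?addr0 // => j jx.
by rewrite !mxE eqxx (negPf jx) /= conjC0 mulr0.
Qed.

Lemma trace_zero_state N : \tr (zero_state R N) = 1.
Proof.
rewrite trace_entry (bigD1 (nseq_tuple N false)) //= entry_zero_state eqxx.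
by rewrite big1 ?addr0 // => x xz; rewrite entry_zero_state (negPf xz).
Qed.

Lemma density_zero_state N : density (zero_state R N).
Proof. by split; [apply: psd_zero_state | apply: trace_zero_state]. Qed.

Lemma trace_conj k (rho K : qop R k) : \tr (K *m rho *m K^t*) = \tr (K^t* *m K *m rho).
Proof. by rewrite mxtrace_mulC mulmxA. Qed.

Section Gates.
Variables (N k : nat) (ws : seq nat).
Hypothesis ok : good_wires N k ws.

Lemma density_apply_qoperation (E : qoperation R k) (rho : qop R N) :
  density rho -> density (apply_qoperation ws E rho).
Proof.
move=> [rho0 tr1]; split.
  by apply: psd_sum => K; apply: psd_conj.
rewrite /apply_qoperation raddf_sum /=; under eq_bigr do rewrite trace_conj -lift_adj -lift_mul //.
rewrite -raddf_sum -mulmx_suml -lift_sum kraus_complete lift_id //.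
by rewrite mul1mx.
Qed.

Lemma density_apply_unitary (U : qop R k) (rho : qop R N) :
  U^t* *m U = 1%:M -> density rho -> density (apply_unitary ws U rho).
Proof.
move=> U1 [rho0 tr1]; split; first exact: psd_conj.
by rewrite trace_conj -lift_adj -lift_mul // U1 lift_id // mul1mx.
Qed.

End Gates.

(** A permutation matrix when [g] is injective. The CNOT and Toffoli gates and the honest prover's
    operation have this form. *)
Definition perm_op (k : nat) (g : k.-tuple bool -> k.-tuple bool) : qop R k :=
  mkop (fun x y => (x == g y)%:R).

Lemma perm_op_unitary k (g : k.-tuple bool -> k.-tuple bool) :
  injective g -> (perm_op g)^t* *m perm_op g = 1%:M.
Proof.
move=> gI; apply: entry_inj => x y; rewrite entry_mul entry_id (bigD1 (g x)) //=.
rewrite entry_adj !entryE eqxx conjC1 mul1r (inj_eq gI) big1 ?addr0 // => z zx.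
by rewrite entry_adj entryE (negPf zx) conjC0 mul0r.
Qed.

Definition cnot_map (y : 2.-tuple bool) : 2.-tuple bool :=
  let b := nth false y in [tuple b 0%N; b 1%N (+) b 0%N].

Lemma cnot_perm : cnot R = perm_op cnot_map.
Proof. by apply: entry_inj => x y; rewrite /perm_op !entryE. Qed.

Lemma cnot_unitary : (cnot R)^t* *m cnot R = 1%:M.
Proof.
rewrite cnot_perm; apply: perm_op_unitary => x y.
by case/tupleP: x => a x; case/tupleP: x => b x; case/tupleP: y => c y; case/tupleP: y => d y;
   rewrite [x]tuple0 [y]tuple0; move: a b c d => [] [] [] [] /(congr1 val) //= [] // *; apply/val_inj.
Qed.

Lemma toffoli_unitary : (toffoli R)^t* *m toffoli R = 1%:M.
Proof.
have -> : toffoli R = perm_op (fun y : 3.-tuple bool => let b := nth false y in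
    [tuple b 0%N; b 1%N; b 2%N (+) (b 0%N && b 1%N)]).
  by apply: entry_inj => x y; rewrite /perm_op !entryE.
apply: perm_op_unitary => x y.
case/tupleP: x => a x; case/tupleP: x => b x; case/tupleP: x => e x.
case/tupleP: y => c y; case/tupleP: y => d y; case/tupleP: y => f y.
by rewrite [x]tuple0 [y]tuple0; move: a b c d e f => [] [] [] [] [] [] /(congr1 val) //= [] // *; apply/val_inj.
Qed.

Lemma sum_tuple1 (F : 1.-tuple bool -> C) : \sum_z F z = F [tuple true] + F [tuple false].
Proof.
rewrite (reindex (fun b : bool => [tuple b])) /=; last first.
  exists (fun z => thead z) => [b _|z _] //; case/tupleP: z => b z; apply/val_inj => /=.
  by rewrite [z]tuple0.
by rewrite big_bool.
Qed.

Lemma tuple1P (x : 1.-tuple bool) : exists b, x = [tuple b].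
Proof. by case/tupleP: x => b x; exists b; rewrite [x]tuple0; apply/val_inj. Qed.

Lemma hadamard_unitary : (hadamard R)^t* *m hadamard R = 1%:M.
Proof.
pose c : C := (sqrtC 2%:R)^-1.
have c2 : c * c = 2^-1 by rewrite /c -expr2 exprVn sqrtCK.
have half : 2^-1 + 2^-1 = 1 :> C by rewrite [RHS]splitr div1r.
have cJ (d : bool) : (c * (-1) ^+ d)^* = c * (-1) ^+ d.
  by rewrite rmorphM /= rmorph_sign; congr (_ * _); rewrite geC0_conj // invr_ge0 sqrtC_ge0 ler0n.
have E (a b : bool) : entry (hadamard R) [tuple a] [tuple b] = c * (-1) ^+ (a && b).
  exact: entryE.
have prod (d d' : bool) : c * (-1) ^+ d * (c * (-1) ^+ d') = 2^-1 * (-1) ^+ (d (+) d').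
  by rewrite mulrACA c2 signr_addb.
apply: entry_inj => x y; have [a ->] := tuple1P x; have [b ->] := tuple1P y.
rewrite entry_mul sum_tuple1 !entry_adj !E !cJ !prod entry_id.
move: (2^-1 : C) half => h half.
by case: a; case: b; rewrite /= -?val_eqE /= ?expr0 ?expr1 ?mulr1 ?mulrN1 ?subrr ?addNr.
Qed.

Lemma phase_unitary : (phase R)^t* *m phase R = 1%:M.
Proof.
have E (a b : bool) : entry (phase R) [tuple a] [tuple b] = (a == b)%:R * 'i ^+ b.
  have T : ([tuple a] == [tuple b]) = (a == b) by case: a; case: b.
  by rewrite entryE T; case: eqP => [->|_]; rewrite ?mul0r.
apply: entry_inj => x y; have [a ->] := tuple1P x; have [b ->] := tuple1P y.
rewrite entry_mul sum_tuple1 !entry_adj !E entry_id.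
have iJ : 'i^* * 'i = 1 :> C by rewrite conjCi mulNr -expr2 sqrCi opprK.
by case: a; case: b; rewrite /= -?val_eqE /= ?expr0 ?expr1 ?mul1r ?mul0r ?mulr0 ?conjC0 ?mul0r
  ?conjC1 ?mulr1 ?addr0 ?add0r.
Qed.

(** * Runs of circuits: preservation of density operators and linearity *)

Section Run.
Variable A : quantum_oracle R.

Lemma good_gate_wires N g : gate_wf A N g ->
  good_wires N (match g with Had _ | Phase _ => 1 | CNot _ _ => 2 | Toffoli _ _ _ => 3
    | Call n _ => oracle_qubits A n end) (gate_wires g).
Proof.
by case/and3P => uw lw ex; apply/and3P; split=> //; case: g ex {uw lw} => //= n ws /andP[].
Qed.

Lemma density_run_gate N g (rho : qop R N) :
  gate_wf A N g -> density rho -> density (run_gate A rho g).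
Proof.
move/good_gate_wires; case: g => [i|i|i j|i j l|n ws] /= ok.
- by apply: density_apply_unitary => //; apply: hadamard_unitary.
- by apply: density_apply_unitary => //; apply: phase_unitary.
- by apply: density_apply_unitary => //; apply: cnot_unitary.
- by apply: density_apply_unitary => //; apply: toffoli_unitary.
- exact: density_apply_qoperation.
Qed.

Lemma density_run N c (rho : qop R N) :
  circuit_wf A N c -> density rho -> density (run A c rho).
Proof.
elim: c rho => //= g c IHc rho /andP[gok cok] rho1.
by apply: IHc => //; apply: density_run_gate.
Qed.

Lemma apply_qoperation_linear N k ws (E : qoperation R k) a (rho sigma : qop R N) :
  apply_qoperation ws E (a *: rho + sigma)
  = a *: apply_qoperation ws E rho + apply_qoperation ws E sigma.
Proof.
rewrite /apply_qoperation scaler_sumr -big_split /=; apply: eq_bigr => K _.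
by rewrite mulmxDr mulmxDl -scalemxAr -scalemxAl.
Qed.

Lemma apply_unitary_linear N k ws (U : qop R k) a (rho sigma : qop R N) :
  apply_unitary ws U (a *: rho + sigma)
  = a *: apply_unitary ws U rho + apply_unitary ws U sigma.
Proof. by rewrite /apply_unitary mulmxDr mulmxDl -scalemxAr -scalemxAl. Qed.

Lemma run_linear N c a (rho sigma : qop R N) :
  run A c (a *: rho + sigma) = a *: run A c rho + run A c sigma.
Proof.
elim: c rho sigma => //= g c IHc rho sigma; rewrite -IHc; congr run.
by case: g => * /=; rewrite ?apply_unitary_linear ?apply_qoperation_linear.
Qed.

Lemma run_scale_sum N c a I (r : seq I) (F : I -> qop R N) :
  run A c (a *: \sum_(i <- r) F i) = a *: \sum_(i <- r) run A c (F i).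
Proof.
have run0 : run A c 0 = 0 :> qop R N.
  by have := run_linear c (-1) 0 (0 : qop R N); rewrite scaler0 addr0 scaleN1r addNr.
rewrite -[_ *: _]addr0 run_linear run0 addr0; congr (_ *: _).
elim: r => [|i r IHr]; first by rewrite !big_nil.
by rewrite !big_cons -[F i]scale1r run_linear IHr !scale1r.
Qed.

End Run.

Lemma prob_one_bounds N (rho : qop R N) : density rho -> 0 <= prob_one rho <= 1.
Proof.
move=> [rho0 tr1]; have diag0 x : 0 <= entry rho x x := psd_diag x rho0.
have s0 : 0 <= \sum_(x : N.-tuple bool | nth false x 0) entry rho x x by apply: sumr_ge0.
have s1 : \sum_(x : N.-tuple bool | nth false x 0) entry rho x x <= 1.
  rewrite -tr1 trace_entry [X in _ <= X](bigID (fun x : N.-tuple bool => nth false x 0)) /=.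
  by rewrite lerDl; apply: sumr_ge0.
by move: s0 s1; rewrite /prob_one !lecE /= => /andP[_ ->] /andP[_ ->].
Qed.

Lemma prob_one_scale_sum N (a : R) I (r : seq I) (F : I -> qop R N) :
  prob_one (a%:C%C *: \sum_(i <- r) F i) = a * \sum_(i <- r) prob_one (F i).
Proof.
have ReD (u v : C) : complex.Re (u + v) = complex.Re u + complex.Re v by case: u v => [? ?] [? ?].
have Re_sum J (s : seq J) (P : pred J) (G : J -> C) :
    complex.Re (\sum_(j <- s | P j) G j) = \sum_(j <- s | P j) complex.Re (G j).
  by elim/big_rec2: _ => // j x y _ <-; rewrite ReD.
have ReZ (u : C) : complex.Re (a%:C%C * u) = a * complex.Re u.
  by case: u => u1 u2 /=; rewrite mul0r subr0.
rewrite /prob_one Re_sum; under eq_bigr do rewrite entry_scale ReZ entry_sum Re_sum.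
rewrite -mulr_sumr exchange_big /=; congr (_ * _).
by apply: eq_bigr => i _; rewrite Re_sum.
Qed.

End Operators.

(** * Sampling oracles *)

Section Sampling.
Variable R : realType.
Local Open Scope ring_scope.
Local Open Scope sesquilinear_scope.
Local Notation C := R[i].

Lemma entry_conj k (L rho : qop R k) x y :
  entry (L *m rho *m L^t*) x y
  = \sum_z \sum_z' entry L x z * entry rho z z' * (entry L y z')^*.
Proof.
rewrite entry_mul; under eq_bigr do rewrite entry_mul entry_adj mulr_suml.
exact: exchange_big.
Qed.

Section Sampler.
Variables (k : nat) (T : finType) (T_gt0 : (0 < #|T|)%N) (D : T -> k.-tuple bool).

Definition sampler_weight : C := (sqrtC #|T|%:R)^-1.

(** The operator [|D t><u| / sqrt #|T|], which discards the old content [u] and writes the sample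
    [D t]. *)
Definition sampler_kraus (p : T * k.-tuple bool) : qop R k :=
  mkop (fun x y => sampler_weight * ((x == D p.1) && (y == p.2))%:R).

Lemma sampler_weightJ : sampler_weight^* = sampler_weight.
Proof. by rewrite geC0_conj // invr_ge0 sqrtC_ge0 ler0n. Qed.

Lemma sampler_weight2 : sampler_weight * sampler_weight = #|T|%:R^-1.
Proof. by rewrite -expr2 exprVn sqrtCK. Qed.

Lemma card_neq0 : #|T|%:R != 0 :> C.
Proof. by rewrite pnatr_eq0 -lt0n. Qed.

Lemma sampler_complete :
  \sum_(K <- [seq sampler_kraus p | p <- enum {: T * k.-tuple bool}]) (K^t* *m K) = 1%:M.
Proof.
rewrite big_map big_enum /=; apply: entry_inj => x y; rewrite entry_sum entry_id.
transitivity (\sum_(p : T * k.-tuple bool) #|T|%:R^-1 * ((x == p.2) && (y == p.2))%:R : C).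
  apply: eq_bigr => -[t u] _; rewrite entry_mul (bigD1 (D t)) //= big1 ?addr0 => [|z zt].
    rewrite entry_adj !entryE eqxx rmorphM /= conjC_nat sampler_weightJ mulrACA.
    by rewrite sampler_weight2 -natrM mulnb.
  by rewrite !entryE (negPf zt) mulr0 mulr0.
rewrite -(pair_bigA _ (fun (_ : T) u => #|T|%:R^-1 * ((x == u) && (y == u))%:R)) /=.
rewrite sumr_const -mulr_sumr -mulrnAl -mulr_natr mulVf ?card_neq0 // mul1r.
rewrite (bigD1 x) //= eqxx big1 ?addr0 1?eq_sym // => z zx.
by rewrite eq_sym (negPf zx).
Qed.

Definition sampler : qoperation R k := QOperation sampler_complete.

(* The part of the state off the wires [ws], the other wires being traced out. *)
Definition off_wires (N : nat) (ws : seq nat) (rho : qop R N) (x y : N.-tuple bool) : C :=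
  \sum_z \sum_z' (agree ws x z && agree ws y z')%:R
    * (read_wires k ws z == read_wires k ws z')%:R * entry rho z z'.

(** The new state is a tensor product: the uniform mixture of the [D t] on [ws], and the reduced
    state of [rho] elsewhere. *)
Lemma entry_sampler N ws (rho : qop R N) x y :
  good_wires N k ws ->
  entry (apply_qoperation ws sampler rho) x y =
  #|T|%:R^-1 * \sum_t ((read_wires k ws x == D t) && (read_wires k ws y == D t))%:R
    * off_wires ws rho x y.
Proof.
move=> ok; rewrite /apply_qoperation big_map big_enum /= entry_sum.
transitivity (\sum_(p : T * k.-tuple bool) \sum_z \sum_z' #|T|%:R^-1 *
   (((read_wires k ws x == D p.1) && (read_wires k ws y == D p.1))%:R *
    ((agree ws x z && agree ws y z')%:R *
     ((read_wires k ws z == p.2) && (read_wires k ws z' == p.2))%:R * entry rho z z')) : C).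
  apply: eq_bigr => -[t u] _; rewrite entry_conj.
  apply: eq_bigr => z _; apply: eq_bigr => z' _; rewrite !entry_lift // !entryE /=.
  rewrite -sampler_weight2.
  case: (agree ws x z); case: (agree ws y z'); rewrite /= ?conjC0 ?mul0r ?mulr0 ?mul0r ?mulr0 //.
  rewrite rmorphM /= conjC_nat sampler_weightJ.
  case: (_ == D t); case: (_ == D t); case: (_ == u); case: (_ == u);
   rewrite /= ?mulr0 ?mul0r ?mulr0 ?mulr1 ?mul1r //.
  by rewrite -mulrA [entry _ _ _ * _]mulrC mulrA.
rewrite -(pair_bigA _ (fun (t : T) u => \sum_z \sum_z' #|T|%:R^-1 *
   (((read_wires k ws x == D t) && (read_wires k ws y == D t))%:R *
    ((agree ws x z && agree ws y z')%:R *
     ((read_wires k ws z == u) && (read_wires k ws z' == u))%:R * entry rho z z')))) /=.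
rewrite mulr_sumr; apply: eq_bigr => t _; rewrite exchange_big /= /off_wires !mulr_sumr.
apply: eq_bigr => z _; rewrite exchange_big /= !mulr_sumr; apply: eq_bigr => z' _.
rewrite -!mulr_sumr -mulr_suml -mulr_sumr; congr (_ * (_ * (_ * _ * _))).
rewrite (bigD1 (read_wires k ws z)) //= eqxx big1 ?addr0 1?eq_sym // => u uz.
by rewrite eq_sym (negPf uz).
Qed.

End Sampler.

Lemma card_unit_gt0 : (0 < #|{: unit}|)%N. Proof. by rewrite card_unit. Qed.

Definition resetter k (s : k.-tuple bool) : qoperation R k :=
  sampler card_unit_gt0 (fun=> s).

(** The branch of a fixed sample does not remember how the sample was drawn, which is what the
    hybrid argument exploits. *)
Lemma sampler_resetter k (T : finType) (T_gt0 : (0 < #|T|)%N) (D : T -> k.-tuple bool)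
    N ws (rho : qop R N) :
  good_wires N k ws ->
  apply_qoperation ws (sampler T_gt0 D) rho
  = (#|T|%:R^-1)%:C%C *: \sum_t apply_qoperation ws (resetter (D t)) rho.
Proof.
move=> ok; apply: entry_inj => x y; rewrite entry_sampler // entry_scale entry_sum.
congr (_ * _); first by rewrite fmorphV rmorph_nat.
apply: eq_bigr => t _; rewrite entry_sampler // card_unit invr1 mul1r.
by rewrite big_const card_unit /= addr0.
Qed.

(** * Permutations of basis states *)

Lemma lift_perm N k ws (g : k.-tuple bool -> k.-tuple bool) :
  good_wires N k ws ->
  lift_op N ws (perm_op R g)
  = perm_op R (fun x => write_wires ws x (g (read_wires k ws x))).
Proof.
move=> ok; apply: entry_inj => x y; rewrite entry_lift // !entryE.
case: (x =P write_wires _ _ _) => [->|ne].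
  by rewrite agree_sym agree_write // read_write // eqxx.
case: ifP => // xy; case: eqP => // rx; case: ne.
by rewrite -rx write_read // agree_sym.
Qed.

Lemma entry_perm_conj k (h : k.-tuple bool -> k.-tuple bool) (rho : qop R k) x y :
  involutive h ->
  entry (perm_op R h *m rho *m (perm_op R h)^t*) x y = entry rho (h x) (h y).
Proof.
move=> hK; have hE u v : (u == h v) = (v == h u) by apply/eqP/eqP => ->; rewrite hK.
rewrite entry_conj (bigD1 (h x)) //= [X in _ + X]big1 ?addr0 => [|z zx].
  rewrite (bigD1 (h y)) //= big1 ?addr0 => [|z zy].
    by rewrite !entryE !hK !eqxx conjC1 mul1r mulr1.
  by rewrite !entryE (hE y z) (negPf zy) conjC0 mulr0.
apply: big1 => z' _.
by rewrite !entryE (hE x z) (negPf zx) !mul0r.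
Qed.

(** A diagonal state. The states of the honest run and of the simulation are of this form and evolve
    by permutations, so comparing them amounts to comparing sampled strings. *)
Definition mixture (T : finType) N (D : T -> N.-tuple bool) : qop R N :=
  mkop (fun x y => #|T|%:R^-1 * \sum_t ((x == D t) && (y == D t))%:R).

Lemma eq_mixture (T : finType) N (D D' : T -> N.-tuple bool) :
  D =1 D' -> mixture D = mixture D'.
Proof. by move=> DD'; congr mixture; apply/funext. Qed.

Lemma mixture_perm (T : finType) N (D : T -> N.-tuple bool) h :
  perm_op R h *m mixture D *m (perm_op R h)^t* = mixture (h \o D).
Proof.
apply: entry_inj => x y; rewrite entry_conj entryE mulr_sumr.
transitivity (\sum_z \sum_z' \sum_t #|T|%:R^-1 *
    (((x == h z) && (y == h z'))%:R * ((z == D t) && (z' == D t))%:R) : C).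
  apply: eq_bigr => z _; apply: eq_bigr => z' _; rewrite !entryE conjC_nat.
  rewrite -mulr_sumr -mulr_sumr -mulnb natrM; ring.
under eq_bigr do rewrite exchange_big /=.
rewrite exchange_big /=; apply: eq_bigr => t _.
rewrite (bigD1 (D t)) //= [X in _ + X]big1 ?addr0 => [|z /negPf zt].
  rewrite (bigD1 (D t)) //= big1 ?addr0 => [|z /negPf zt].
    by rewrite !eqxx mulr1.
  by rewrite zt andbF !mulr0.
by apply: big1 => z' _; rewrite zt !mulr0.
Qed.

Lemma prob_one_mixture (T : finType) N (D : T -> N.-tuple bool) :
  (0 < #|T|)%N -> (forall t, nth false (D t) 0) -> prob_one (mixture D) = 1.
Proof.
move=> T_gt0 D1; rewrite /prob_one.
suff -> : \sum_(x : N.-tuple bool | nth false x 0) entry (mixture D) x x = 1 :> C by [].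
under eq_bigr do rewrite entryE; rewrite -mulr_sumr exchange_big /=.
under eq_bigr => t _.
  rewrite (bigD1 (D t)) ?D1 //= eqxx big1 ?addr0 => [|z /andP[_ /negPf ->] //].
  over.
by rewrite sumr_const mulVf // pnatr_eq0 -lt0n.
Qed.

Definition cnot_wires N (a b : nat) (x : N.-tuple bool) : N.-tuple bool :=
  [tuple if val i == b then nth false x b (+) nth false x a else tnth x i | i < N].

Lemma nth_tuple N (f : 'I_N -> bool) i (iN : (i < N)%N) :
  nth false [tuple f i | i < N] i = f (Ordinal iN).
Proof. by rewrite -[i in LHS]/(val (Ordinal iN)) -tnth_nth tnth_mktuple. Qed.

Lemma nth_cnot_wires N a b (x : N.-tuple bool) i :
  (b < N)%N ->
  nth false (cnot_wires a b x) i =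
  if i == b then nth false x b (+) nth false x a else nth false x i.
Proof.
move=> bN; case: (ltnP i N) => iN.
  by rewrite nth_tuple /= (tnth_nth false).
rewrite [LHS]nth_default ?size_tuple // ifF; last by apply/eqP => ib; move: iN; rewrite ib leqNgt bN.
by rewrite nth_default ?size_tuple.
Qed.

Lemma cnot_wiresK N a b : a != b -> (b < N)%N -> involutive (@cnot_wires N a b).
Proof.
move=> ab bN x; apply: eq_from_tnth => i; rewrite !(tnth_nth false) !nth_cnot_wires //.
by rewrite eqxx (negPf ab) -addbA addbb addbF; case: eqP => [->|].
Qed.

Lemma lift_cnot N a b :
  a != b -> (a < N)%N -> (b < N)%N ->
  lift_op N [:: a; b] (cnot R) = perm_op R (@cnot_wires N a b).
Proof.
move=> ab aN bN; rewrite cnot_perm lift_perm; last first.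
  by rewrite /good_wires /= inE ab aN bN.
congr perm_op; apply/funext => x.
have r0 : nth false (read_wires 2 [:: a; b] x) 0 = nth false x a := nth_tuple _ (isT : (0 < 2)%N).
have r1 : nth false (read_wires 2 [:: a; b] x) 1 = nth false x b := nth_tuple _ (isT : (1 < 2)%N).
have -> : cnot_map (read_wires 2 [:: a; b] x) = [tuple nth false x a; nth false x b (+) nth false x a].
  by rewrite -r0 -r1.
apply: eq_from_tnth => i; rewrite !tnth_mktuple !inE.
case: (eqVneq (val i) a) => [ia|ia] /=.
  by rewrite ia eqxx (negPf ab) /= (tnth_nth false) ia.
by case: eqP => [ib|//]; rewrite ib /= (negPf ab) eqxx.
Qed.

(** * Partial traces *)

(** The measured qubit is among those kept, so acceptance can be computed on the global state,
    prover included. *)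
Lemma prob_one_ptrace n p (rho : qop R (n + p)) :
  (0 < n)%N -> prob_one (ptrace rho : qop R n) = prob_one rho.
Proof.
move=> n0; rewrite /prob_one; congr complex.Re.
under eq_bigr do rewrite entryE.
rewrite pair_big_dep /=.
pose join (u : n.-tuple bool * p.-tuple bool) : (n + p).-tuple bool := cat_tuple u.1 u.2.
pose cut (t : (n + p).-tuple bool) : n.-tuple bool * p.-tuple bool :=
  ([tuple tnth t (lshift p i) | i < n], [tuple tnth t (rshift n i) | i < p]).
have cutK : cancel cut join.
  move=> t; apply: eq_from_tnth => i.
  by case: (split_ordP i) => j ->; rewrite ?tnth_lshift ?tnth_rshift tnth_mktuple.
have joinK : cancel join cut.
  move=> [x z]; congr pair; apply: eq_from_tnth => i;
  by rewrite tnth_mktuple ?tnth_lshift ?tnth_rshift.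
rewrite [in RHS](reindex join) /=; last by exists cut => ? _; rewrite ?joinK ?cutK.
apply: eq_bigl => -[x z] /=; rewrite andbT nth_cat size_tuple n0 //.
Qed.

Lemma spectral_diag0 m : spectral_diag (0 : 'M[C]_m) = 0.
Proof.
have n0 : (0 : 'M[C]_m) \is normalmx by apply/normalmxP; rewrite mulmx0 mul0mx.
have /orthomx_spectralP sp := n0.
have P_unit := unitarymx_unit (spectral_unitarymx (0 : 'M[C]_m)).
have diag0 : diag_mx (spectral_diag (0 : 'M[C]_m)) = 0.
  have := congr1 (fun M => spectralmx (0 : 'M[C]_m) *m M *m invmx (spectralmx (0 : 'M[C]_m))) sp.
  by rewrite mulmx0 mul0mx !mulmxA mulmxV // mul1mx mulmxK // => <-.
apply/rowP => i; have := congr1 (fun M : 'M_m => M i i) diag0.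
by rewrite !mxE eqxx mulr1n.
Qed.

(** The simulation below is perfect, so no other trace distance has to be computed. *)
Lemma trace_distance_refl k (rho : qop R k) : trace_distance rho rho = 0.
Proof.
rewrite /trace_distance /trace_norm subrr.
have -> : (0 : qop R k)^t* *m (0 : qop R k) = (0 : qop R k).
  by apply/matrixP => i j; rewrite !mxE big1 // => l _; rewrite !mxE mulr0.
rewrite spectral_diag0 big1 ?mul0r // => i _.
by rewrite mxE sqrtC0.
Qed.

End Sampling.

(** * The oracle, its samples and its language *)

Definition oracle_spec := nat -> option (seq bool -> bool).

Definition sample_bit (c : bool) (y : seq bool) (i : nat) : bool :=
  match i with 0 => c | 1 => ~~ c | 2 => false | i'.+3 => nth false y i' end.

(* Decreasing, because a Turing machine produces the wires most easily in this order. *)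
Definition call_wires (j : nat) : seq nat := rev (iota 0 j).

(** Indexed through [call_wires], so that the reversal cancels: a call on these wires leaves
    [sample_bit c y i] on wire [i]. *)
Definition sample (j : nat) (c : bool) (y : seq bool) : j.-tuple bool :=
  [tuple sample_bit c y (nth 0%N (call_wires j) i) | i < j].

Lemma card_bits_gt0 n : (0 < #|{: n.-tuple bool}|)%N.
Proof. by rewrite card_tuple expn_gt0 card_bool. Qed.

Lemma card_bool_bits_gt0 n : (0 < #|{: bool * n.-tuple bool}|)%N.
Proof. by rewrite card_prod muln_gt0 card_bool card_bits_gt0. Qed.

Lemma mem_call_wires j w : (w \in call_wires j) = (w < j)%N.
Proof. by rewrite mem_rev mem_iota add0n. Qed.

Lemma good_call_wires N j : (j <= N)%N -> good_wires N j (call_wires j).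
Proof.
move=> jN; rewrite /good_wires rev_uniq iota_uniq size_rev size_iota eqxx andbT /=.
by apply/allP => w; rewrite mem_call_wires => /leq_trans; apply.
Qed.

Lemma read_sample N j c y (x : N.-tuple bool) :
  (read_wires j (call_wires j) x == sample j c y)
  = [forall i : 'I_j, nth false x i == sample_bit c y i].
Proof.
apply/eqP/forallP => [rx i|h].
  have iw : (i : nat) \in call_wires j by rewrite mem_call_wires.
  have lt : (index (i : nat) (call_wires j) < j)%N.
    by move: iw; rewrite -index_mem size_rev size_iota.
  have := congr1 (fun t => tnth t (Ordinal lt)) rx; rewrite !tnth_mktuple /= nth_index //.
  by move=> ->.
apply: eq_from_tnth => i; rewrite !tnth_mktuple.
have iw : (nth 0%N (call_wires j) i < j)%N.
  by rewrite -mem_call_wires mem_nth // size_rev size_iota.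
exact/eqP/(h (Ordinal iw)).
Qed.

Section SamplingOracle.
Variable R : realType.
Local Open Scope ring_scope.
Local Open Scope sesquilinear_scope.
Local Notation C := R[i].

(** [j.-2.-1] reduces to [n] at [j = n.+3], the index used for inputs of length [n]; for [j < 3] the
    string [y] is empty. *)
Definition spec_op (o : option (seq bool -> bool)) (j : nat) : qoperation R j :=
  if o is Some f then
    sampler R (card_bits_gt0 j.-2.-1) (fun y => sample j (f y) y)
  else sampler R (card_bool_bits_gt0 j.-2.-1) (fun u => sample j u.1 u.2).

Lemma identity_qubits_poly : exists p : {poly nat}, forall n, (n <= p.[n]%R)%N.
Proof. by exists 'X => n; rewrite hornerX. Qed.

Definition sampling_oracle (F : oracle_spec) : quantum_oracle R :=
  @QuantumOracle R id identity_qubits_poly (fun j => spec_op (F j) j).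

Definition spec_language (F : oracle_spec) : classical_sets.set (seq bool) :=
  fun x => F (size x).+3 <> None.

Variable F : oracle_spec.

(** * The protocol *)

Section Protocol.
Variable n : nat.

Definition call_circuit : circuit := [:: Call n.+3 (call_wires n.+3)].

(** Wires 0 and 1 stay private, wire 2 is the blank for the answer and the others carry [y]. The
    last gate adds the answer to [c] on wire 0, the one that is measured, so that exactly the answer
    [~~ c] is accepted. *)
Definition guess_verifier : verifier :=
  Verifier 2 n.+1 [:: call_circuit] [:: CNot 2 0].

Definition guess_simulator : seq preparation :=
  [:: (0%N, call_circuit); (0%N, rcons call_circuit (CNot 1 2))].

Lemma call_circuit_wf M : (n.+3 <= M)%N -> circuit_wf (sampling_oracle F) M call_circuit.
Proof.
move=> nM; rewrite /circuit_wf /= andbT /gate_wf /=.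
case/and3P: (good_call_wires nM) => -> -> ->.
by [].
Qed.

Lemma guess_verifier_wf : verifier_wf (sampling_oracle F) guess_verifier.
Proof. by apply/and3P; split=> //; apply: (call_circuit_wf (leqnn n.+3)). Qed.

Lemma guess_simulator_wf j (s := nth (0%N, [::]) guess_simulator j) :
  (j < 2)%N -> circuit_wf (sampling_oracle F) (n.+3 + s.1) s.2.
Proof.
have wf := call_circuit_wf (leq_addr 0 n.+3).
rewrite {}/s; case: j => [|[|//]] _; first exact: wf.
by apply/andP; split; [case/andP: wf |].
Qed.

Section Soundness.
Variables (priv : nat).
Let M := (2 + n.+1 + priv)%N.

Definition flip01 (x : M.-tuple bool) : M.-tuple bool :=
  [tuple if (i < 2)%N then ~~ tnth x i else tnth x i | i < M].

Lemma nth_flip01 x i :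
  (i < M)%N -> nth false (flip01 x) i = if (i < 2)%N then ~~ nth false x i else nth false x i.
Proof. by move=> iM; rewrite nth_tuple (tnth_nth false). Qed.

Lemma flip01K : involutive flip01.
Proof.
move=> x; apply: eq_from_tnth => i; rewrite !tnth_mktuple.
by case: (i < 2)%N; rewrite ?negbK.
Qed.

Definition flip_invariant (rho : qop R M) :=
  forall x y, entry rho (flip01 x) (flip01 y) = entry rho x y.

(** The flip carries the sample of [c] to that of [~~ c], which only permutes the uniform index set
    when no function is hidden. Any prior state will do, since the flipped wires are among those
    overwritten. *)
Lemma flip_invariant_call (rho : qop R M) :
  F n.+3 = None -> flip_invariant (run (sampling_oracle F) call_circuit rho).
Proof.
move=> Fn x y; have ok : good_wires M n.+3 (call_wires n.+3).
  by apply: good_call_wires; rewrite /M leq_addr.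
have agree_flip (z : M.-tuple bool) t : agree (call_wires n.+3) (flip01 z) t = agree (call_wires n.+3) z t.
  apply/agreeP/agreeP => h i iw; rewrite -h // tnth_mktuple ifF //;
  by move: iw; rewrite mem_call_wires; case: i => i /=; lia.
have read_flip (z : M.-tuple bool) c u :
    (read_wires n.+3 (call_wires n.+3) (flip01 z) == sample n.+3 c u)
    = (read_wires n.+3 (call_wires n.+3) z == sample n.+3 (~~ c) u).
  rewrite !read_sample; apply: eq_forallb => i.
  have iM : (i < M)%N by apply: leq_trans (ltn_ord i) _; rewrite /M leq_addr.
  rewrite nth_flip01 //; case: i {iM} => -[|[|[|i]]] //= _; rewrite ?negbK //;
  by case: (nth _ _ _); case: c.
rewrite /= Fn /= !entry_sampler //; congr (_ * _).
rewrite (reindex_inj (h := fun u : bool * n.-tuple bool => (~~ u.1, u.2))) /=; last first.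
  by move=> [a u] [b v] /= [/negb_inj -> ->].
apply: eq_bigr => -[c u] _ /=; rewrite !read_flip negbK; congr (_ * _).
apply: eq_bigr => z _; apply: eq_bigr => z' _.
by rewrite !agree_flip.
Qed.

(** The lifted operators of the prover act off wires 0 and 1, hence commute with the flip. *)
Lemma flip_invariant_prover (E : qoperation R (n.+1 + priv)) (rho : qop R M) :
  flip_invariant rho -> flip_invariant (apply_qoperation (iota 2 (n.+1 + priv)) E rho).
Proof.
move=> inv x y; rewrite /apply_qoperation !entry_sum; apply: eq_bigr => K _.
have ok : good_wires M (n.+1 + priv) (iota 2 (n.+1 + priv)).
  rewrite /good_wires iota_uniq size_iota eqxx andbT /=.
  by apply/allP => w; rewrite mem_iota /M; lia.
have lift_flip u v : entry (lift_op M (iota 2 (n.+1 + priv)) K) (flip01 u) (flip01 v)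
    = entry (lift_op M (iota 2 (n.+1 + priv)) K) u v.
  have read_flip w : read_wires (n.+1 + priv) (iota 2 (n.+1 + priv)) (flip01 w)
      = read_wires (n.+1 + priv) (iota 2 (n.+1 + priv)) w.
    apply: eq_from_tnth => i; rewrite !tnth_mktuple nth_iota //.
    by rewrite nth_flip01 // /M; have := ltn_ord i; lia.
  rewrite !entry_lift // !read_flip; congr (if _ then _ else _).
  apply/agreeP/agreeP => h i iw; last by rewrite !tnth_mktuple h.
  have := h i iw; rewrite !tnth_mktuple; case: ifP => // _ /negb_inj //.
rewrite !entry_conj (reindex_inj (inv_inj flip01K)); apply: eq_bigr => z _.
rewrite (reindex_inj (inv_inj flip01K)); apply: eq_bigr => z' _.
by rewrite !lift_flip inv.
Qed.

(** Acceptance means that wires 0 and 2 differ. The flip negates wire 0 only among these two, so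
    both outcomes have equal probability, and these sum to the trace. *)
Lemma flip_invariant_guess (rho : qop R M) :
  flip_invariant rho -> density rho ->
  prob_one (run (sampling_oracle F) [:: CNot 2 0] rho) = 2^-1.
Proof.
move=> inv [_ tr1]; rewrite /prob_one.
have M2 : (2 < M)%N by rewrite /M; lia.
have M0 : (0 < M)%N by rewrite /M; lia.
pose S (b : bool) : C := \sum_(x : M.-tuple bool | nth false x 0 (+) nth false x 2 == b) entry rho x x.
have -> : \sum_(x : M.-tuple bool | nth false x 0)
    entry (run (sampling_oracle F) [:: CNot 2 0] rho : qop R M) x x = S true.
  rewrite /S (reindex_inj (inv_inj (cnot_wiresK (isT : (2 != 0)%N) M0))) /=.
  apply: eq_big => [x|x _]; first by rewrite nth_cnot_wires.
  by rewrite /apply_unitary lift_cnot // entry_perm_conj ?cnot_wiresK //; exact: cnot_wiresK.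
have SF : S false = S true.
  rewrite /S (reindex_inj (inv_inj flip01K)); apply: eq_big => [x|x _]; last exact: inv.
  by rewrite !nth_flip01 //=; case: (nth _ _ _); case: (nth _ _ _).
have : S true + S false = 1.
  rewrite -tr1 trace_entry [RHS](bigID (fun x : M.-tuple bool => nth false x 0 (+) nth false x 2)) /=.
  by congr (_ + _); apply: eq_bigl => x; rewrite ?eqb_id ?eqbF_neg.
rewrite SF; case: (S true) => a b /= [] ha _.
by apply: (@mulfI _ 2%:R); rewrite ?pnatr_eq0 // mulfV ?pnatr_eq0 // mulr_natl mulr2n.
Qed.

End Soundness.

Lemma guess_soundness (P : prover R (vmsg guess_verifier)) :
  F n.+3 = None -> interaction_accept_prob (sampling_oracle F) P = 2^-1.
Proof.
move=> Fn; rewrite /interaction_accept_prob prob_one_ptrace //.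
apply: flip_invariant_guess.
  exact/flip_invariant_prover/flip_invariant_call.
apply: density_apply_qoperation.
  rewrite /good_wires iota_uniq size_iota eqxx andbT /=.
  by apply/allP => w; rewrite mem_iota; lia.
apply: (@density_run _ (sampling_oracle F)); last exact: density_zero_state.
by apply: call_circuit_wf; rewrite leq_addr.
Qed.

Section Completeness.
Variable f : seq bool -> bool.
Hypothesis Ff : F n.+3 = Some f.
Let M := (2 + n.+1 + 0)%N.

(* The sampled basis state, with [g] written on the wire of the prover's answer. *)
Definition sampled (g : bool) (y : n.-tuple bool) : M.-tuple bool :=
  [tuple if val i == 2%N then g else sample_bit (f y) y i | i < M].

(** The honest prover has no private qubits, so the call covers the whole register and the off-wire
    factor is 1. *)
Lemma run_call_zero_state :
  run (sampling_oracle F) call_circuit (zero_state R M) = mixture R (sampled false).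
Proof.
have ok : good_wires M n.+3 (call_wires n.+3).
  by apply: good_call_wires; rewrite /M leq_addr.
apply: entry_inj => x y; rewrite /= Ff entry_sampler // entryE.
congr (_ * _); apply: eq_bigr => t _.
have -> : off_wires n.+3 (call_wires n.+3) (zero_state R M) x y = 1.
  have all_agree (u v : M.-tuple bool) : agree (call_wires n.+3) u v.
    by apply/agreeP => i; rewrite mem_call_wires; case: i => i /=; rewrite /M; lia.
  rewrite /off_wires (bigD1 (nseq_tuple M false)) //= [X in _ + X]big1 ?addr0 => [|z zz].
    rewrite (bigD1 (nseq_tuple M false)) //= big1 ?addr0 => [|z zz].
      by rewrite !all_agree !eqxx entry_zero_state !eqxx !mul1r.
    by rewrite entry_zero_state (negPf zz) andbF mulr0.
  by apply: big1 => z' _; rewrite entry_zero_state (negPf zz) mulr0.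
have readE (u : M.-tuple bool) :
    (read_wires n.+3 (call_wires n.+3) u == sample n.+3 (f t) t) = (u == sampled false t).
  rewrite read_sample; apply/forallP/eqP => [h|-> i].
    apply: eq_from_tnth => i; rewrite tnth_mktuple (tnth_nth false).
    have iN : (i < n.+3)%N by case: i => i /=; rewrite /M; lia.
    by have /eqP -> := h (Ordinal iN); rewrite /=; case: eqP => // ->.
  have iM : (i < M)%N by apply: leq_trans (ltn_ord i) _; rewrite /M leq_addr.
  rewrite nth_tuple /=.
  by have -> : (if i == 2 :> nat then false else sample_bit (f t) t i) = sample_bit (f t) t i
    by case: (nat_of_ord i) => [|[|[|]]].
by rewrite !readE mulr1.
Qed.

(** The answer is added to its wire, which makes the operation reversible; on the blank wire this
    writes it. *)
Definition answer_map (u : (n.+1 + 0).-tuple bool) : (n.+1 + 0).-tuple bool :=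
  [tuple if val i == 0%N then tnth u i (+) ~~ f (behead u) else tnth u i | i < n.+1 + 0].

Lemma nth_answer_map u i :
  (i < n.+1 + 0)%N ->
  nth false (answer_map u) i =
  if i == 0%N then nth false u i (+) ~~ f (behead u) else nth false u i.
Proof. by move=> iN; rewrite nth_tuple /= (tnth_nth false). Qed.

Lemma behead_answer_map u : behead (answer_map u) = behead u :> seq bool.
Proof.
apply: (@eq_from_nth _ false) => [|i]; first by rewrite !size_behead !size_tuple.
rewrite size_behead size_tuple => iN; by rewrite !nth_behead nth_answer_map //; move: iN; lia.
Qed.

Lemma answer_mapK : involutive answer_map.
Proof.
move=> u; apply: eq_from_tnth => i; rewrite !(tnth_nth false) nth_answer_map //.
rewrite behead_answer_map nth_answer_map //.
by case: (nat_of_ord i == 0%N); rewrite // -addbA addbb addbF.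
Qed.

Lemma answer_complete :
  \sum_(K <- [:: perm_op R answer_map]) (K^t* *m K) = 1%:M.
Proof. by rewrite big_seq1 perm_op_unitary //; exact: inv_inj answer_mapK. Qed.

Definition honest_prover : prover R (vmsg guess_verifier) :=
  @Prover R n.+1 0 (fun=> QOperation answer_complete).

Lemma nth_sampled g y i :
  (i < M)%N -> nth false (sampled g y) i = if i == 2%N then g else sample_bit (f y) y i.
Proof. by move=> iM; rewrite nth_tuple. Qed.

Lemma sampled_cnot12 (y : n.-tuple bool) : cnot_wires 1 2 (sampled false y) = sampled (~~ f y) y.
Proof.
have M2 : (2 < M)%N by rewrite /M; lia.
have M1 : (1 < M)%N by rewrite /M; lia.
apply: eq_from_tnth => i; rewrite !(tnth_nth false) nth_cnot_wires // !nth_sampled //.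
by case: eqP.
Qed.

Lemma nth0_answer (y : n.-tuple bool) : nth false (cnot_wires 2 0 (sampled (~~ f y) y)) 0.
Proof.
have M2 : (2 < M)%N by rewrite /M; lia.
have M0 : (0 < M)%N by rewrite /M; lia.
by rewrite nth_cnot_wires // !nth_sampled //=; case: (f y).
Qed.

Lemma answer_sampled (y : n.-tuple bool) :
  write_wires (iota 2 (n.+1 + 0)) (sampled false y)
    (answer_map (read_wires (n.+1 + 0) (iota 2 (n.+1 + 0)) (sampled false y)))
  = sampled (~~ f y) y.
Proof.
set u := read_wires _ _ _.
have uE i : (i < n.+1 + 0)%N -> nth false u i = if i == 0%N then false else nth false y i.-1.
  move=> iN; rewrite (nth_tuple _ iN) [X in nth _ _ X]/= (nth_iota _ _ iN) nth_sampled.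
    by case: i iN.
  by move: iN; rewrite /M; lia.
have uy : behead u = y :> seq bool.
  apply: (@eq_from_nth _ false) => [|i]; first by rewrite size_behead !size_tuple addn0.
  by rewrite size_behead size_tuple => iN; rewrite nth_behead uE //; move: iN; lia.
apply: eq_from_tnth => i; rewrite tnth_mktuple mem_iota.
have iM := ltn_ord i.
case: (ltnP i 2) => i2.
  by rewrite andFb !(tnth_nth false) !nth_sampled //; case: eqP => // ei; move: i2; rewrite ei.
have iN : (i - 2 < n.+1 + 0)%N by move: iM; rewrite /M; lia.
rewrite andTb (iM : (val i < 2 + (n.+1 + 0))%N).
have -> : index (val i) (iota 2 (n.+1 + 0)) = (i - 2)%N.
  rewrite -[val i](subnKC i2) -(nth_iota 0%N 2 iN) index_uniq ?size_iota ?iota_uniq //.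
rewrite nth_answer_map // uy !uE // (tnth_nth false) nth_sampled //.
by move: i2; case: (nat_of_ord i) => [|[|[|m]]].
Qed.

Lemma round_state1 :
  round_state (sampling_oracle F) honest_prover 1
  = mixture R (fun y : n.-tuple bool => sampled (~~ f y) y).
Proof.
have ok : good_wires M (n.+1 + 0) (iota 2 (n.+1 + 0)).
  rewrite /good_wires iota_uniq size_iota eqxx andbT /=.
  by apply/allP => w; rewrite mem_iota /M; lia.
rewrite -[LHS]/(apply_qoperation (iota 2 (n.+1 + 0)) (QOperation answer_complete)
   (run (sampling_oracle F) call_circuit (zero_state R M))).
rewrite run_call_zero_state /apply_qoperation big_seq1 lift_perm // mixture_perm.
by apply: eq_mixture => y; apply: answer_sampled.
Qed.

Lemma run_cnot a b (T : finType) (D : T -> M.-tuple bool) :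
  a != b -> (a < M)%N -> (b < M)%N ->
  run (sampling_oracle F) [:: CNot a b] (mixture R D) = mixture R (cnot_wires a b \o D).
Proof. by move=> ab aM bM; rewrite /= /apply_unitary lift_cnot // mixture_perm. Qed.

Lemma guess_completeness : interaction_accept_prob (sampling_oracle F) honest_prover = 1.
Proof.
have M2 : (2 < M)%N by rewrite /M; lia.
have M0 : (0 < M)%N by rewrite /M; lia.
rewrite /interaction_accept_prob prob_one_ptrace //.
rewrite -[size _]/1%N round_state1 run_cnot // prob_one_mixture ?card_bits_gt0 //.
exact: nth0_answer.
Qed.

(** The simulator uses no ancilla and the prover no private qubit, so both sides are partial traces
    from the same register. *)
Lemma guess_simulation j (s := nth (0%N, [::]) guess_simulator j) :
  (j < 2)%N ->
  prepared_state (sampling_oracle F) (2 + n.+1) s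
  = verifier_view (sampling_oracle F) honest_prover j.+1.
Proof.
have M2 : (2 < M)%N by rewrite /M; lia.
have M1 : (1 < M)%N by rewrite /M; lia.
rewrite {}/s; case: j => [|[|//]] _; first by [].
rewrite /verifier_view -[message_state _ _ _]/(round_state (sampling_oracle F) honest_prover 1).
rewrite round_state1 /prepared_state; congr ptrace.
rewrite -[run _ _ _]/(run (sampling_oracle F) [:: CNot 1 2]
  (run (sampling_oracle F) call_circuit (zero_state R M))).
rewrite run_call_zero_state run_cnot //; apply: eq_mixture => y.
exact: sampled_cnot12.
Qed.

End Completeness.
End Protocol.

(** * Uniformity of the protocol *)

(** The counter is 0 before and after, so that such scripts can be chained. *)
Definition emits (p : seq command) (n : nat) (out : seq bool) : Prop :=
  forall o, exec n p (0%N, o) = (0%N, o ++ out).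

Lemma exec_cat n p q r : exec n (p ++ q) r = exec n q (exec n p r).
Proof. exact: foldl_cat. Qed.

Lemma emits_cat p q n u v : emits p n u -> emits q n v -> emits (p ++ q) n (u ++ v).
Proof. by move=> pu qv o; rewrite exec_cat pu qv catA. Qed.

Lemma emits_const s n : emits (map Emit s) n s.
Proof.
elim: s => [|b s IHs] o; first by rewrite cats0.
by rewrite -[LHS]/(exec n (map Emit s) (0%N, rcons o b)) IHs cat_rcons.
Qed.

Lemma exec_incs k n o r :
  exec n (nseq k Inc) (r, o) = ((r + k)%N, o).
Proof. by elim: k r => [|k IHk] r; rewrite ?addn0 //= IHk addnS. Qed.

Definition number_script (k : nat) : seq command :=
  Load :: nseq k Inc ++ [:: Flush; Emit false].

Lemma emits_number k n : emits (number_script k) n (enc_nat (n + k)).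
Proof.
by move=> o; rewrite /exec /= foldl_cat [foldl _ _ (nseq _ _)]exec_incs /= -cats1 catA.
Qed.

Definition wires_script (k : nat) : seq command :=
  Load :: nseq k Inc ++ [:: Tri; Emit false].

Lemma emits_wires k n :
  emits (wires_script k) n (enc_seq enc_nat (call_wires (n + k))).
Proof.
have tri j : triangle j = flatten [seq true :: enc_nat w | w <- call_wires j].
  elim: j => // j IHj.
  have -> : call_wires j.+1 = j :: call_wires j.
    by rewrite /call_wires -addn1 iotaD rev_cat add0n.
  by rewrite [LHS]/= IHj /enc_nat /= -catA.
move=> o; rewrite /exec /= foldl_cat [foldl _ _ (nseq _ _)]exec_incs /=.
by rewrite /enc_seq -tri -cats1 catA.
Qed.

Definition call_script : seq command :=
  map Emit (enc_nat 4) ++ number_script 3 ++ wires_script 3.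

Lemma emits_call n : emits call_script n (enc_gate (Call n.+3 (call_wires n.+3))).
Proof.
rewrite -[n.+3]addn3; apply: emits_cat; first exact: emits_const.
by apply: emits_cat; [apply: emits_number | apply: emits_wires].
Qed.

Definition verifier_script : seq command :=
  map Emit (enc_nat 2) ++ number_script 1 ++ map Emit [:: true; true] ++ call_script
  ++ map Emit ([:: false; false] ++ enc_circuit [:: CNot 2 0]).

Lemma emits_verifier n : emits verifier_script n (enc_verifier (guess_verifier n)).
Proof.
have -> : enc_verifier (guess_verifier n) = enc_nat 2 ++ enc_nat (n + 1) ++ [:: true; true]
    ++ enc_gate (Call n.+3 (call_wires n.+3)) ++ ([:: false; false] ++ enc_circuit [:: CNot 2 0]).
  rewrite /enc_verifier addn1; congr (_ ++ (_ ++ _)).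
  by rewrite enc_seq_cons /enc_circuit /call_circuit enc_seq_cons /= -!catA.
exact: (emits_cat (emits_const _ _) (emits_cat (emits_number 1 n)
  (emits_cat (emits_const _ _) (emits_cat (emits_call n) (emits_const _ _))))).
Qed.

Definition simulator_script : seq command :=
  map Emit [:: true; false; true] ++ call_script ++ map Emit [:: false; true; false; true]
  ++ call_script ++ map Emit (true :: enc_gate (CNot 1 2) ++ [:: false; false]).

Lemma emits_simulator n :
  emits simulator_script n (enc_seq enc_algorithm (guess_simulator n)).
Proof.
have -> : enc_seq enc_algorithm (guess_simulator n) =
    [:: true; false; true] ++ enc_gate (Call n.+3 (call_wires n.+3)) ++ [:: false; true; false; true]
    ++ enc_gate (Call n.+3 (call_wires n.+3)) ++ (true :: enc_gate (CNot 1 2) ++ [:: false; false]).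
  rewrite /guess_simulator !enc_seq_cons /enc_algorithm /enc_circuit /call_circuit /rcons.
  by rewrite !enc_seq_cons /= -!catA.
exact: (emits_cat (emits_const _ _) (emits_cat (emits_call n)
  (emits_cat (emits_const _ _) (emits_cat (emits_call n) (emits_const _ _))))).
Qed.

Lemma constant_threshold (u v : seq bool) :
  polytime_threshold (fun=> (binary_value u)%:R / (binary_value v)%:R : R).
Proof.
exists (fun=> (u, v)); split=> //.
by apply: (polytime_exec (p := map Emit (enc_pair (u, v)))) => s; rewrite emits_const.
Qed.

Lemma spec_language_QSZK_HV : QSZK_HV (sampling_oracle F) (spec_language F).
Proof.
(* Bits are read least significant first, so the thresholds are [1 / 1] and [1 / 2]; the simulation
   error is 0. *)
exists (fun x => guess_verifier (size x)),
  (fun=> (binary_value [:: true])%:R / (binary_value [:: true])%:R),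
  (fun=> (binary_value [:: true])%:R / (binary_value [:: false; true])%:R),
  (fun x => guess_simulator (size x)), (fun=> 0).
have one : (binary_value [:: true])%:R / (binary_value [:: true])%:R = 1 :> R by rewrite divr1.
have half : (binary_value [:: true])%:R / (binary_value [:: false; true])%:R = 2^-1 :> R by rewrite mul1r.
split.
- split=> [|x]; last exact: guess_verifier_wf.
  by apply: (polytime_exec (p := verifier_script)) => s; rewrite emits_verifier.
- split; [exact: constant_threshold | exact: constant_threshold |].
  exists (2%N)%:P => n; rewrite hornerC one half; split=> //.
  by rewrite [X in _ <= X - _](splitr 1) div1r addrK.
- split; first by apply: (polytime_exec (p := simulator_script)) => s; rewrite emits_simulator.
  by move=> p; exists 0%N => n _; rewrite normr0 mul0r ler01.
- move=> x; rewrite /spec_language; case Fx: (F _) => [f|//] _.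
  exists (honest_prover (size x) f); split; first by rewrite one guess_completeness.
  split=> // j j2; split; first exact: guess_simulator_wf.
  by rewrite -guess_simulation // trace_distance_refl.
- move=> x; rewrite /spec_language; case Fx: (F _) => [f|] nL P; first by case: nL.
  by rewrite half guess_soundness.
Qed.

End SamplingOracle.

(** * Classical witnesses do not help *)

Definition update (F : oracle_spec) (j : nat) (o : option (seq bool -> bool)) : oracle_spec :=
  fun i => if i == j then o else F i.

Lemma update_same F j o : update F j o j = o.
Proof. by rewrite /update eqxx. Qed.

Section Hybrid.
Variable R : realType.
Local Open Scope ring_scope.
Variables (F : oracle_spec) (n : nat).
Let Y : finType := {: n.-tuple bool}.

Definition oracle_with (o : option (seq bool -> bool)) : quantum_oracle R :=
  sampling_oracle R (update F n.+3 o).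

Local Notation A0 := (oracle_with None).

Definition reset_call N ws (rho : qop R N) (b : bool) (y : Y) : qop R N :=
  apply_qoperation ws (resetter R (sample n.+3 b y)) rho.

(* The functions of the random string [y] on which the oracles with and without
   hidden function have to look alike in a run of the circuit. *)
Fixpoint tests N (c : circuit) (rho : qop R N) : seq {ffun Y -> R} :=
  if c is g :: c' then
    if g is Call m ws then
      if m == n.+3 then
        [ffun y => prob_one (run A0 c' (reset_call ws rho true y))
                   - prob_one (run A0 c' (reset_call ws rho false y))]
        :: flatten [seq tests c' (reset_call ws rho u.1 u.2) | u : (bool * Y)%type]
      else tests c' (run_gate A0 rho g)
    else tests c' (run_gate A0 rho g)
  else [::].

Lemma size_flatten_bound (T : Type) (ss : seq (seq T)) K :
  all (fun s => size s <= K)%N ss -> (size (flatten ss) <= size ss * K)%N.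
Proof.
elim: ss => //= s ss IHss /andP[sK /IHss ssK].
by rewrite size_cat mulSn leq_add.
Qed.

(** A call branches into [2 ^ n.+1] samples and adds one test of its own; the exponent [n.+2] makes
    room for the latter. *)
Lemma size_tests N c (rho : qop R N) : (size (tests c rho) <= 2 ^ (n.+2 * size c))%N.
Proof.
elim: c rho => [|g c IHc] rho //=.
have le_step : (2 ^ (n.+2 * size c) <= 2 ^ (n.+2 * (size c).+1))%N.
  by rewrite leq_exp2l // leq_mul2l leqnSn orbT.
have next r : (size (tests c r) <= 2 ^ (n.+2 * (size c).+1))%N := leq_trans (IHc r) le_step.
case: g => // m ws; case: ifP => // _ /=.
apply: (@leq_ltn_trans (2 * 2 ^ n * 2 ^ (n.+2 * size c))).
  have -> : (2 * 2 ^ n)%N = size [seq tests c (reset_call ws rho u.1 u.2) | u : (bool * Y)%type].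
    by rewrite size_map -cardE card_prod card_bool card_tuple card_bool.
  by apply: size_flatten_bound; apply/allP => s /mapP[u _ ->].
rewrite -expnS -expnD ltn_exp2l // mulnS; lia.
Qed.

Lemma good_call_wires_of N m ws c :
  circuit_wf A0 N (Call m ws :: c) -> good_wires N m ws /\ circuit_wf A0 N c.
Proof. by case/andP => /good_gate_wires. Qed.

Lemma density_reset_call N ws (rho : qop R N) b y :
  good_wires N n.+3 ws -> density rho -> density (reset_call ws rho b y).
Proof. by move=> ok rho1; rewrite /reset_call; apply: density_apply_qoperation. Qed.

Lemma tests_bounded N c (rho : qop R N) a y :
  circuit_wf A0 N c -> density rho -> a \in tests c rho -> `|a y| <= 1.
Proof.
elim: c rho => [|g c IHc] rho //= /[dup] wf /andP[gwf cwf] rho1.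
have next : a \in tests c (run_gate A0 rho g) -> `|a y| <= 1.
  by apply: IHc => //; apply: density_run_gate.
case: g wf gwf next => //= m ws wf gwf next; case: eqP => // mn; subst m.
have [ok _] := good_call_wires_of wf.
rewrite inE => /orP[/eqP ->|/flattenP[s /mapP[u _ ->]]]; last first.
  by apply: IHc => //; apply: density_reset_call.
have bounds b : 0 <= prob_one (run A0 c (reset_call ws rho b y)) <= 1.
  by apply: prob_one_bounds; apply: density_run => //; apply: density_reset_call.
rewrite ffunE ler_norml; have /andP[] := bounds true; have /andP[] := bounds false.
by move: (prob_one _) (prob_one _) => u v; lra.
Qed.

Section Hidden.
Variables (f : seq bool -> bool) (e : nat).
Hypothesis e_gt0 : (0 < e)%N.
Local Notation Af := (oracle_with (Some f)).

(** The sign is [+1] where [f y] holds: [f] has correlation at most [1 / e] with [a]. *)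
Definition balanced (a : {ffun Y -> R}) : Prop :=
  `|\sum_(y : Y) (-1) ^+ (~~ f y) * a y| * e%:R <= #|Y|%:R.

Lemma cardY : #|Y| = (2 ^ n)%N.
Proof. by rewrite card_tuple card_bool. Qed.

Lemma run_call_hidden N ws (rho : qop R N) c :
  good_wires N n.+3 ws ->
  prob_one (run Af (Call n.+3 ws :: c) rho)
  = #|Y|%:R^-1 * \sum_(y : Y) prob_one (run Af c (reset_call ws rho (f y) y)).
Proof.
move=> ok; rewrite /= update_same /= sampler_resetter //.
by rewrite run_scale_sum prob_one_scale_sum.
Qed.

Lemma run_call_uniform N ws (rho : qop R N) c :
  good_wires N n.+3 ws ->
  prob_one (run A0 (Call n.+3 ws :: c) rho)
  = #|Y|%:R^-1 * \sum_(y : Y) (prob_one (run A0 c (reset_call ws rho true y))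
                             + prob_one (run A0 c (reset_call ws rho false y))) / 2.
Proof.
move=> ok; rewrite /= update_same /= sampler_resetter //.
rewrite run_scale_sum prob_one_scale_sum card_prod card_bool natrM invfM mulrC mulrA mulrC.
congr (_ * _); rewrite -mulr_suml; congr (_ * _).
rewrite -(pair_bigA _ (fun b (y : Y) => prob_one (run A0 c (reset_call ws rho b y)))) /=.
by rewrite big_bool big_split.
Qed.

(** At a call, induction removes the hidden function from the rest of the run, for each sample
    separately. Replacing the bit [f y] by a uniform one then costs half the correlation of [f] with
    the test of this call, that is at most [1 / (2 * e)]. *)
Lemma hybrid N c (rho : qop R N) :
  circuit_wf A0 N c -> density rho ->
  (forall a, a \in tests c rho -> balanced a) ->
  `|prob_one (run Af c rho) - prob_one (run A0 c rho)| <= (size c)%:R / (2 * e)%:R.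
Proof.
have e0 : 0 < (2 * e)%:R :> R by rewrite ltr0n muln_gt0.
have e1 : 0 < e%:R :> R by rewrite ltr0n.
elim: c rho => [|g c IHc] rho /=; first by rewrite subrr normr0 mul0r.
move=> /[dup] wf /andP[gwf cwf] rho1 bal.
have next : (forall a, a \in tests c (run_gate A0 rho g) -> balanced a) ->
    run_gate Af rho g = run_gate A0 rho g ->
  `|prob_one (run Af c (run_gate Af rho g)) - prob_one (run A0 c (run_gate A0 rho g))|
    <= (size c).+1%:R / (2 * e)%:R.
  move=> balg ->; apply: le_trans (IHc _ cwf _ balg) _; first exact: density_run_gate.
  by rewrite ler_pM2r ?invr_gt0 // ler_nat.
case: g wf gwf bal next => [i|i|i j|i j l|m ws] wf gwf bal next; try exact: next.
move: bal next => /=; case: eqP => [mn|mn] bal next; last first.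
  by apply: next => //; rewrite /update; case: eqP mn.
subst m => {next}; have [ok _] := good_call_wires_of wf.
have := run_call_hidden rho c ok; rewrite /= => ->.
have := run_call_uniform rho c ok; rewrite /= => ->.
have M0 : 0 < #|Y|%:R :> R by rewrite cardY ltr0n expn_gt0.
set pf := fun y : Y => prob_one (run Af c (reset_call ws rho (f y) y)).
set p0 := fun b (y : Y) => prob_one (run A0 c (reset_call ws rho b y)).
rewrite -mulrBr -sumrB.
(* One of two numbers minus their mean is half their difference, with a sign given by [f y]. *)
have -> : \sum_(y : Y) (pf y - (p0 true y + p0 false y) / 2)
  = \sum_(y : Y) (pf y - p0 (f y) y) + 2^-1 * \sum_(y : Y) (-1) ^+ (~~ f y) * (p0 true y - p0 false y).
  rewrite mulr_sumr -big_split; apply: eq_bigr => y _ /=.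
  by case: (f y) => /=; rewrite ?expr0 ?expr1; field.
rewrite normrM ger0_norm ?invr_ge0 ?ler0n // mulrC ler_pdivrMr //.
apply: le_trans (ler_normD _ _) _.
have -> : (size c).+1%:R / (2 * e)%:R * #|Y|%:R
    = \sum_(y : Y) (size c)%:R / (2 * e)%:R + 2^-1 * (#|Y|%:R / e%:R) :> R.
  by rewrite sumr_const -[X in X + _]mulr_natr -natr1 natrM; field; rewrite gt_eqF.
apply: lerD.
  apply: le_trans (ler_norm_sum _ _ _) _; apply: ler_sum => y _.
  apply: IHc => //; first exact: density_reset_call.
  move=> a ac; apply: bal; rewrite inE; apply/orP; right; apply/flattenP.
  exists (tests c (reset_call ws rho (f y) y)) => //.
  by apply/mapP; exists (f y, y) => //; rewrite mem_enum.
rewrite normrM ger0_norm ?invr_ge0 ?ler0n // ler_pM2l ?invr_gt0 // ler_pdivlMr //.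
have := bal _ (mem_head _ _); rewrite /balanced.
by under eq_bigr do rewrite ffunE.
Qed.

End Hidden.

(** With [e = 2 * B + 1] the total error [B / (2 * e)] is below [1 / 3]. The exponent
    [P + n.+2 * B + 3] accounts for the number of witnesses, the tests of each and the closure under
    negation. *)
Lemma hidden_function (V : seq bool -> algorithm) (P B : nat) (e := (2 * B).+1) :
  (forall w, circuit_wf A0 (V w).1 (V w).2) ->
  (forall w, (size w <= P)%N -> (size (V w).2 <= B)%N) ->
  (8 * e ^ 2 * (P + n.+2 * B + 3) <= 2 ^ n)%N ->
  exists f : seq bool -> bool, forall w, (size w <= P)%N ->
    accept_prob (oracle_with (Some f)) (V w) < accept_prob A0 (V w) + 3%:R^-1.
Proof.
move=> wf szV big.
pose A := flatten [seq tests (V w).2 (zero_state R (V w).1) | w : P.-bseq bool].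
have A1 a : a \in A -> forall y, `|a y| <= 1.
  case/flattenP => s /mapP[w _ ->] aw y; apply: tests_bounded aw => //.
  exact: density_zero_state.
have card_w : (#|{: P.-bseq bool}| < 2 ^ P.+1)%N.
  rewrite card_bseq card_bool; elim: {A A1 szV big} P => [|p IHp]; first by rewrite big_ord1.
  by rewrite big_ord_recr /= [X in (_ < X)%N]expnS mul2n -addnn ltn_add2r.
have szA : (2 * size A < 2 ^ (P + n.+2 * B + 3))%N.
  apply: (@leq_ltn_trans (2 * (#|{: P.-bseq bool}| * 2 ^ (n.+2 * B)))).
    rewrite leq_mul2l /= cardE -(size_map (fun w : P.-bseq bool => tests (V w).2 (zero_state R (V w).1))).
    apply: size_flatten_bound; apply/allP => s /mapP[w _ ->].
    apply: leq_trans (size_tests _ _) _; rewrite leq_exp2l // leq_mul2l szV ?orbT //.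
    exact: size_bseq.
  rewrite (_ : P + n.+2 * B + 3 = 1 + (P.+1 + n.+2 * B + 1))%N; last by lia.
  rewrite expnD expn1 ltn_pmul2l // [X in (_ < X)%N]expnD expn1 muln2 -addnn.
  rewrite -[X in (X < _)%N]add0n -addSn leq_add ?expn_gt0 // expnD.
  by rewrite leq_mul // ltnW.
have [sigma sigmaA] := discrepancy (isT : (0 < e)%N) szA
  (eq_ind_r (fun m => (8 * e ^ 2 * (P + n.+2 * B + 3) <= m)%N) big cardY) A1.
(* Strings of length other than [n] get a default value; the operation at [n.+3] samples [n] bits
   only. *)
exists (fun s => ~~ sigma (insubd (nseq_tuple n false) s)) => w wP.
have bal a : a \in tests (V w).2 (zero_state R (V w).1) ->
    balanced (fun s => ~~ sigma (insubd (nseq_tuple n false) s)) e a.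
  move=> aw; rewrite /balanced; under eq_bigr do rewrite valKd negbK.
  apply: sigmaA; apply/flattenP; exists (tests (V w).2 (zero_state R (V w).1)) => //.
  by apply/mapP; exists (Bseq wP) => //; rewrite mem_enum.
have := hybrid (isT : (0 < e)%N) (wf w) (density_zero_state R _) bal.
rewrite -/(accept_prob _ _) -/(accept_prob _ _) ler_norml => /andP[_].
rewrite lerBlDl => /le_lt_trans; apply; rewrite ltrD2l.
rewrite ltr_pdivrMr ?ltr0n // -ltr_pdivrMl ?invr_gt0 ?ltr0n // invrK -natrM ltr_nat.
by have := szV w wP; rewrite /e; lia.
Qed.

End Hybrid.

Lemma accept_prob_local (R : realType) (F F' : oracle_spec) b (q : algorithm) :
  calls_below b q.2 -> (forall j, (j < b)%N -> F j = F' j) ->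
  accept_prob (sampling_oracle R F) q = accept_prob (sampling_oracle R F') q.
Proof.
move=> cb FF'; rewrite /accept_prob; congr prob_one.
case: q cb => N c /=; elim: c (zero_state R N) => //= g c IHc rho /andP[gb cb].
by rewrite IHc //; case: g gb => //= m ws mb; rewrite FF'.
Qed.

(** * Diagonalization *)

(* Tapes, states and pickled transition table of a machine, coefficients of its
   time bound and of the bound on the witness length. *)
Definition verifier_code := (nat * nat * nat * seq nat * seq nat)%type.

Definition choose_or (T : Type) (x0 : T) (P : T -> Prop) : T :=
  if pselect (exists x, P x) is left exP then sval (cid exP) else x0.

Lemma choose_orP (T : Type) (x0 : T) (P : T -> Prop) :
  (exists x, P x) -> P (choose_or x0 P).
Proof. by rewrite /choose_or; case: pselect => // exP _; apply: (svalP (cid exP)). Qed.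

Section Diagonalization.
Variable R : realType.
Local Open Scope ring_scope.

Definition time_poly (c : verifier_code) : {poly nat} := Poly c.1.2.
Definition witness_poly (c : verifier_code) : {poly nat} := Poly c.2.

Definition computes (c : verifier_code) (V : seq bool * seq bool -> algorithm) : Prop :=
  let: (k, m, a, _, _) := c in
  exists2 b : tm_table k m, unpickle a = Some b & forall s,
    tm_outputs (tm_of_table b) (enc_pair s) (time_poly c).[size (enc_pair s)]
      (enc_algorithm (V s)).

(** Well-formedness sees only the numbers of qubits, the same for all sampling oracles, so it can be
    stated before the oracle is built. *)
Definition well_formed (V : seq bool * seq bool -> algorithm) : Prop :=
  forall u, circuit_wf (sampling_oracle R (fun=> None)) (V u).1 (V u).2.

Lemma computes_unique c V V' : computes c V -> computes c V' -> V = V'.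
Proof.
case: c => [[[[k m] a] q] p] [b ab bV] [b' ab' bV'].
move: ab'; rewrite ab => -[bb']; rewrite -{}bb' in bV'.
apply/funext => s; apply: enc_algorithm_inj; apply: eq_from_onth => i.
by have [_ <-] := bV s; have [_ <-] := bV' s.
Qed.

Lemma polytime_computes V (p : {poly nat}) :
  polytime enc_pair enc_algorithm V -> exists2 c, computes c V & witness_poly c = p.
Proof.
case=> M [q MV]; have [b bM] := tm_table_complete M.
exists (tm_tapes M, #|{: tm_state M}|, pickle b, polyseq q, polyseq p); last exact: polyseqK.
by exists b => [|s]; [exact: pickleK | rewrite /time_poly polyseqK; apply/bM/MV].
Qed.

Definition input_size (c : verifier_code) (n : nat) : nat :=
  (n.*2.+1 + (witness_poly c).[n])%N.

(** Running time plus input length: a bound on the length of the output, hence on both the gates and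
    the call indices. *)
Definition circuit_bound (c : verifier_code) (n : nat) : nat :=
  ((time_poly c).[input_size c n] + input_size c n)%N.

Lemma computes_bounds c V n w :
  computes c V -> (size w <= (witness_poly c).[n])%N ->
  (size (V (nseq n true, w)).2 <= circuit_bound c n)%N /\
  calls_below (circuit_bound c n) (V (nseq n true, w)).2.
Proof.
move=> cV wp; apply: enc_circuit_bounds.
apply: (@leq_trans (size (enc_algorithm (V (nseq n true, w))))).
  by rewrite /enc_algorithm size_cat leq_addl.
have le_in : (size (enc_pair (nseq n true, w)) <= input_size c n)%N.
  by rewrite size_enc_pair size_nseq leq_add2l.
suff le_out : (size (enc_algorithm (V (nseq n true, w)))
    <= (time_poly c).[size (enc_pair (nseq n true, w))] + size (enc_pair (nseq n true, w)))%N.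
  by apply: leq_trans le_out _; apply: leq_add => //; apply: leq_horner.
by case: c cV {wp le_in} => [[[[k m] a] q] p] [b _ bV]; apply: tm_outputs_size (bV _).
Qed.

Definition large_enough (c : verifier_code) (n : nat) : bool :=
  (8 * (2 * circuit_bound c n).+1 ^ 2
     * ((witness_poly c).[n] + n.+2 * circuit_bound c n + 3) <= 2 ^ n)%N.

Lemma large_enough_unbounded c N : exists n, (N <= n)%N && large_enough c n.
Proof.
have pb_in : poly_bounded (input_size c).
  have := poly_boundedD (poly_boundedD (poly_boundedD poly_bounded_id poly_bounded_id)
    (poly_bounded_const 1)) (poly_bounded_horner (witness_poly c) poly_bounded_id).
  by case=> d le_d; exists d => n; move: (le_d n); rewrite /input_size /=; lia.
have pb_B : poly_bounded (circuit_bound c).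
  exact: poly_boundedD (poly_bounded_horner _ pb_in) pb_in.
have pb_e := poly_boundedD (poly_boundedM (poly_bounded_const 2) pb_B) (poly_bounded_const 1).
have [d le_d] := poly_boundedM
  (poly_boundedM (poly_bounded_const 8) (poly_boundedM pb_e pb_e))
  (poly_boundedD (poly_boundedD (poly_bounded_horner (witness_poly c) poly_bounded_id)
    (poly_boundedM (poly_boundedD poly_bounded_id (poly_bounded_const 2)) pb_B))
    (poly_bounded_const 3)).
have [n Nn le_n] := exp2_eventually_large d N.
exists n; rewrite Nn; apply: leq_trans le_n; apply: leq_trans (le_d n).
by rewrite /= addn1 addn2 -[X in (_ * X * _)%N]mulnn.
Qed.

Definition defeated (c : verifier_code) (V : seq bool * seq bool -> algorithm) (n : nat)
    (F : oracle_spec) : Prop :=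
  let acc w := accept_prob (sampling_oracle R F) (V (nseq n true, w)) in
  (F n.+3 = None /\ exists2 w, (size w <= (witness_poly c).[n])%N & 1 / 3%:R < acc w) \/
  (F n.+3 <> None /\ forall w, (size w <= (witness_poly c).[n])%N -> acc w < 2%:R / 3%:R).

(** If some witness is accepted with probability above [1 / 3] when nothing is hidden, soundness
    fails there. Otherwise a hidden function raises every acceptance probability by less than
    [1 / 3], and completeness fails. *)
Lemma defeat c V n F :
  computes c V -> well_formed V -> large_enough c n ->
  exists o, defeated c V n (update F n.+3 o).
Proof.
move=> cV wf big; pose A0 := oracle_with R F n None.
have [[w wp gt]|small] := pselect (exists2 w, (size w <= (witness_poly c).[n])%N &
    1 / 3%:R < accept_prob A0 (V (nseq n true, w))).
  by exists None; left; split; [rewrite update_same | exists w].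
have [f fV] := @hidden_function R F n (fun w => V (nseq n true, w)) (witness_poly c).[n]
  (circuit_bound c n) (fun w => wf _) (fun w wp => (computes_bounds cV wp).1) big.
exists (Some f); right; split=> [|w wp]; first by rewrite update_same.
apply: lt_le_trans (fV w wp) _.
have : accept_prob A0 (V (nseq n true, w)) <= 1 / 3%:R.
  by rewrite leNgt; apply/negP => gt; apply: small; exists w.
by rewrite -/A0; move: (accept_prob A0 _) => u; lra.
Qed.

(** * Stages of the construction and their limit *)

Definition code (k : nat) : verifier_code := odflt (0, 0, 0, [::], [::])%N (unpickle k).

Definition code_verifier (k : nat) : seq bool * seq bool -> algorithm :=
  choose_or (fun=> (0%N, [::])) (computes (code k)).

Definition next_length (k N : nat) : nat := ex_minn (large_enough_unbounded (code k) N).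

(** Each length passes the circuit bound of the preceding stage, so the operations set later are out
    of reach of the verifiers already treated, on the inputs that defeat them. *)
Fixpoint stage_length (k : nat) : nat :=
  if k is k'.+1 then
    next_length k (maxn (stage_length k').+1 (circuit_bound (code k') (stage_length k')))
  else next_length 0 0.

Lemma stage_length_large k : large_enough (code k) (stage_length k).
Proof. by case: k => [|k] /=; rewrite /next_length; case: ex_minnP => n /andP[]. Qed.

Lemma stage_lengthS k :
  (stage_length k < stage_length k.+1)%N /\
  (circuit_bound (code k) (stage_length k) <= stage_length k.+1)%N.
Proof.
rewrite /= /next_length; case: ex_minnP => n /andP[+ _] _.
by rewrite geq_max => /andP[].
Qed.

Lemma leq_stage_length k : (k <= stage_length k)%N.
Proof. by elim: k => // k IHk; apply: leq_ltn_trans IHk (stage_lengthS k).1. Qed.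

Lemma stage_length_mono k d : (stage_length k <= stage_length (k + d))%N.
Proof.
elim: d => [|d IHd]; rewrite ?addn0 // addnS.
exact: leq_trans IHd (ltnW (stage_lengthS _).1).
Qed.

Fixpoint stage (k : nat) : oracle_spec :=
  if k is k'.+1 then
    let n := stage_length k' in
    update (stage k') n.+3
      (choose_or None (fun o => defeated (code k') (code_verifier k') n (update (stage k') n.+3 o)))
  else fun=> None.

(** Index [j] is final there: a stage [k > j] changes only the index [(stage_length k).+3], which
    exceeds [j]. *)
Definition limit_spec : oracle_spec := fun j => stage j.+1 j.

Lemma stage_stable a d j : (j < (stage_length a).+3)%N -> stage (a + d) j = stage a j.
Proof.
move=> ja; elim: d => [|d IHd]; rewrite ?addn0 // addnS /= /update ifF //.
by apply/eqP => je; have := stage_length_mono a d; move: ja; rewrite je; lia.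
Qed.

Lemma limit_stage k j : (j < (stage_length k).+3)%N -> limit_spec j = stage k j.
Proof.
move=> jk; have jj : (j < (stage_length j.+1).+3)%N.
  by have := leq_stage_length j.+1; lia.
by rewrite /limit_spec -(stage_stable k jj) addnC (stage_stable j.+1 jk).
Qed.

(** The limit agrees with stage [k.+1] on every index that verifier [k] can call on its input, so
    the defeat persists. *)
Lemma limit_defeats k :
  computes (code k) (code_verifier k) -> well_formed (code_verifier k) ->
  defeated (code k) (code_verifier k) (stage_length k) limit_spec.
Proof.
move=> cV wf; set n := stage_length k.
have [o oP] := defeat (stage k) cV wf (stage_length_large k).
have : defeated (code k) (code_verifier k) n (stage k.+1).
  by rewrite /= -/n; apply: (choose_orP None (P := fun o => defeated _ _ n (update (stage k) n.+3 o))); exists o.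
have [lt le] := stage_lengthS k.
have accE w : (size w <= (witness_poly (code k)).[n])%N ->
    accept_prob (sampling_oracle R limit_spec) (code_verifier k (nseq n true, w))
    = accept_prob (sampling_oracle R (stage k.+1)) (code_verifier k (nseq n true, w)).
  move=> wp; apply: accept_prob_local (computes_bounds cV wp).2 _ => j jB.
  by apply: limit_stage; apply: leq_trans (leq_trans jB le) _; rewrite -addn3 leq_addr.
rewrite /defeated (@limit_stage k.+1 n.+3); last by rewrite !ltnS.
case=> [[Fn [w wp gt]]|[Fn small]]; [left | right]; split=> //.
  by exists w => //; rewrite accE.
by move=> w wp; rewrite accE // small.
Qed.

Lemma limit_language_not_QCMA :
  ~ QCMA (sampling_oracle R limit_spec) (spec_language limit_spec).
Proof.
case=> V [p [polyV wfV yes no]].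
have [c cV pE] := polytime_computes p polyV.
have [k kc] : exists k, code k = c by exists (pickle c); rewrite /code pickleK.
have VE : code_verifier k = V.
  suff : computes (code k) (code_verifier k) by rewrite kc => /computes_unique; apply.
  by rewrite /code_verifier; apply: choose_orP; exists V; rewrite kc.
have := @limit_defeats k; rewrite VE kc => /(_ cV wfV); set n := stage_length k.
have szx : size (nseq n true) = n by rewrite size_nseq.
rewrite /defeated pE => -[[Fn [w wp gt]]|[Fn small]].
  have := no (nseq n true) _ w; rewrite /spec_language szx Fn => /(_ _ wp).
  by rewrite leNgt gt => h; apply: notF; apply: h => /(_ erefl).
have [|w []] := yes (nseq n true); first by rewrite /spec_language szx.
by rewrite szx => /small lt; rewrite leNgt lt.
Qed.

End Diagonalization.

Local Open Scope classical_set_scope.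

Theorem theorem1p2 (R : realType) :
  exists A : quantum_oracle R, ~ (QSZK_HV A `<=` QCMA A).
Proof.
exists (sampling_oracle R (limit_spec R)) => sub.
exact/(@limit_language_not_QCMA R)/sub/spec_language_QSZK_HV.
Qed.
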